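(* For any positive integer $m$ and $1\le s\le 7$, the number $N(G_2,m,s)$ is given as follows, according to $m\bmod 12$ (values listed in the order $s=1,2,3,4,5,6,7$): - $m\equiv0$: $\;1,\ 1,\ \frac{m}{2},\ 1,\ \frac{m-6}{2},\ \frac{m-4}{4},\ \frac{m(m-9)}{12}+2$; - $m\equiv1,5,7,11$: $\;1,\ 0,\ \frac{m-1}{2},\ 0,\ \frac{m-1}{2},\ 0,\ \frac{(m-1)(m-5)}{12}$; - $m\equiv2,10$: $\;1,\ 1,\ \frac{m-2}{2},\ 0,\ \frac{m-2}{2},\ \frac{m-2}{4},\ \frac{(m-2)(m-7)}{12}$; - $m\equiv3,9$: $\;1,\ 0,\ \frac{m+1}{2},\ 0,\ \frac{m-3}{2},\ 0,\ \frac{(m-3)^2}{12}$; - $m\equiv4,8$: $\;1,\ 1,\ \frac{m-2}{2},\ 1,\ \frac{m-4}{2},\ \frac{m-4}{4},\ \frac{(m-4)(m-5)}{12}$; - $m\equiv6$: $\;1,\ 1,\ \frac{m}{2},\ 0,\ \frac{m-4}{2},\ \frac{m-2}{4},\ \frac{(m-3)(m-6)}{12}$.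
   Context: $G_2$ denotes the complex connected simply-connected simple Lie group of type $G_2$, viewed as a matrix group via its smallest-degree (7-dimensional) faithful representation. $N(G,m,s)$ denotes the number of conjugacy classes of $G$ contained in $\{x\in G: x^m=1,\ x\text{ has exactly } s\text{ distinct eigenvalues}\}$, eigenvalues being taken in this representation. *)

(* Defs.v *)
From mathcomp Require Import all_boot all_order all_algebra.
From mathcomp Require Import finmap complex all_classical reals.
From mathcomp Require Import ring.

Set Implicit Arguments.
Unset Strict Implicit.
Unset Printing Implicit Defensive.

Import Order.TTheory GRing.Theory Num.Theory.
Local Open Scope classical_set_scope.
Local Open Scope ring_scope.

Definition conj_class (F : fieldType) (n : nat) (G : set 'M[F]_n)
  (x : 'M[F]_n) : set 'M[F]_n := [set h *m x *m invmx h | h in G].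

(* [I_s] is the set of natural numbers < s and [#=] is equipotence. *)
Definition torsion_eigen_set (F : fieldType) (n : nat) (G : set 'M[F]_n)
    (m s : nat) : set 'M[F]_n :=
  [set x | [/\ G x, x ^+ m = 1 & ([set a | eigenvalue x a] #= `I_s)%card]].

Definition torsion_eigen_classes (F : fieldType) (n : nat) (G : set 'M[F]_n)
    (m s : nat) : set (set 'M[F]_n) :=
  [set K | (exists2 x, G x & K = conj_class G x) /\
           K `<=` torsion_eigen_set G m s].

(* [fset_set A] is empty when [A] is infinite, so this is the number of classes
   only when [torsion_eigen_classes G m s] is finite. *)
Definition nclasses (F : fieldType) (n : nat) (G : set 'M[F]_n)
  (m s : nat) : nat := #|` fset_set (torsion_eigen_classes G m s)|.

(* Octonions as Zorn's vector matrices: the pair ((a, u), (v, b)) stands for the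
   array with rows (a u) and (v b), where a, b are scalars and u, v are vectors
   of dimension 3.  Over an algebraically closed field this is, up to
   isomorphism, the only octonion algebra. *)
Definition octonion (F : fieldType) : Type :=
  ((F^o * 'rV[F]_3) * ('rV[F]_3 * F^o))%type.

Definition dot3 (F : fieldType) (u v : 'rV[F]_3) : F :=
  \sum_(i < 3) u 0 i * v 0 i.

(* The indices i + 1 and i + 2 are taken modulo 3. *)
Definition cross3 (F : fieldType) (u v : 'rV[F]_3) : 'rV[F]_3 :=
  \row_(i < 3) (u 0 (i + 1) * v 0 (i + 2%:R) - u 0 (i + 2%:R) * v 0 (i + 1)).

Definition oct_mul (F : fieldType) (x y : octonion F) : octonion F :=
  let: ((a, u), (v, b)) := x in
  let: ((c, w), (z, d)) := y in
  ((a * c + dot3 u z,              a *: w + d *: u - cross3 v z),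
   (c *: v + b *: z + cross3 u w,  b * d + dot3 v w)).

Definition oct_norm (F : fieldType) (x : octonion F) : F :=
  let: ((a, u), (v, b)) := x in a * b - dot3 u v.

Lemma oct_normM (F : fieldType) (x y : octonion F) :
  oct_norm (oct_mul x y) = oct_norm x * oct_norm y.
Proof.
case: x => [[a u] [v b]]; case: y => [[c w] [z d]] /=.
rewrite /dot3 !big_ord_recl !big_ord0 /= !mxE.
have e0 : ord0 = 0 :> 'I_3 by apply/val_inj.
have e1 : lift ord0 (ord0 : 'I_2) = 1 :> 'I_3 by apply/val_inj.
have e2 : lift ord0 (lift ord0 (ord0 : 'I_1)) = 2%:R :> 'I_3 by apply/val_inj.
have e3 : 1 + 1 = 2%:R :> 'I_3 by apply/val_inj.
have e4 : 1 + 2%:R = 0 :> 'I_3 by apply/val_inj.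
have e5 : 2%:R + 1 = 0 :> 'I_3 by apply/val_inj.
have e6 : 2%:R + 2%:R = 1 :> 'I_3 by apply/val_inj.
by rewrite !(e0, e1, e2) !(add0r, e3, e4, e5, e6); ring.
Qed.

Definition oct_automorphism (F : fieldType) (f : octonion F -> octonion F) :=
  [/\ linear f, bijective f & {morph f : x y / oct_mul x y}].

(* Coordinates (t, u, v) on the 7-dimensional space of trace-zero octonions;
   an automorphism of the algebra preserves this space. *)
Definition oct_trace0 (F : fieldType) (x : 'rV[F]_(1 + (3 + 3))) : octonion F :=
  let t := lsubmx x 0 0 in
  ((t, lsubmx (rsubmx x)), (rsubmx (rsubmx x), - t)).

(* The group of type G2 is realized as the automorphism group of the octonion
   algebra, given by its matrices (acting on row vectors) on the trace-zero
   octonions, which form the 7-dimensional irreducible representation. *)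
Definition G2 (F : fieldType) : set 'M[F]_7 :=
  [set g | exists2 f : octonion F -> octonion F, oct_automorphism f &
           forall x : 'rV[F]_7, f (oct_trace0 x) = oct_trace0 (x *m g)].

Arguments G2 : clear implicits.

(* Main.v *)
Require Import Defs.
From mathcomp Require Import all_boot all_order all_algebra all_solvable all_field.
From mathcomp Require Import finmap complex all_classical reals.
From mathcomp Require Import ring lra zify.

Set Implicit Arguments.
Unset Strict Implicit.
Unset Printing Implicit Defensive.

Import Order.TTheory GRing.Theory Num.Theory.
Local Open Scope classical_set_scope.
Local Open Scope ring_scope.

(** Write a product of trace-zero octonions as x y = beta(x, y) 1 + x × y, with
    [beta] a nondegenerate symmetric form and [cross] an alternating product.
    An octonion automorphism fixes 1, so G2 is the group of 7 × 7 matrices that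
    preserve both ([G2E]), and the geometry rests on two identities, [beta_cross]
    and [crossA].

    A frame is an axis c with beta(c, c) = 1 together with u1, u2, u3 such that
    c × ui = ui and beta(u1 × u2, u3) = 1/2.  These relations determine the whole
    multiplication table of c, ui and vi = u(i+1) × u(i+2), so the matrix with
    these rows is in G2 ([frame_cross_aut]).  Hence an element of G2 that has the
    vectors of a frame as eigenvectors, with eigenvalues 1, t1, t2, t3, is
    conjugate in G2 to a diagonal matrix, and t1 t2 t3 = 1.  Such a frame exists
    for every g of finite order ([weights_exist]): g fixes some axis c
    ([fixed_axis]), and it commutes with the diagonalizable operator c × _, so a
    common eigenbasis provides u1, u2, u3 ([eigenframe_exists]).  Reordering the
    frame or exchanging the ui and vi permutes the ti and inverts them
    simultaneously, which is the action of the Weyl group.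

    If g^m = 1, the ti are powers of a primitive m-th root of unity z, and the
    Weyl group brings the exponents to the form (a, b, -(a + b)) with a <= b and
    a + 2 b <= m: a lattice point of an alcove ([weights_alcove]).  Distinct
    lattice points give distinct classes, because the characteristic polynomial
    remembers the multiset {0, ±a, ±b, ±(a + b)} modulo m, and the distances of
    its elements to 0 give back a and b ([alcove_elt_inj]).  So N(G2, m, s)
    counts the points of the alcove for which this set has s elements modulo m
    ([nclassesE]).

    That number of elements depends only on the walls and the few special lines
    through (a, b) ([num_eigenE]).  For s <= 6 one counts multiples in an
    interval.  For s = 7 and s = 6 together one counts the points inside the
    alcove; this number grows by n when n becomes n + 6, whence a quadratic
    polynomial in m on every residue class modulo 12. *)

(** * Generalities *)

Section Generalities.
Variable F : numClosedFieldType.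

Lemma half_neq0 : (2^-1 : F) != 0.
Proof. by rewrite invr_eq0 pnatr_eq0. Qed.

Lemma eq_opp0 (V : lmodType F) (a : V) : a = - a -> a = 0.
Proof.
move=> aa; have : (2 : F) *: a = 0 by rewrite scaler_nat mulr2n {1}aa addNr.
by move/eqP; rewrite scaler_eq0 pnatr_eq0 => /eqP.
Qed.

(** X^n - 1 splits into n distinct linear factors in characteristic 0. *)
Lemma prim_root_exists n : (n > 0)%N -> exists z : F, n.-primitive_root z.
Proof.
move=> n_gt0; pose p : {poly F} := 'X^n - 1.
have [r Dp] := closed_field_poly_normal p.
rewrite (monicP _) ?monicXnsubC // scale1r in Dp.
have rn1 : all n.-unity_root r by apply/allP=> z; rewrite -root_prod_XsubC -Dp.
have sz_r : (n < (size r).+1)%N.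
  by rewrite -(size_prod_XsubC r id) -Dp size_XnsubC.
have [|z] := hasP (has_prim_root n_gt0 rn1 _ sz_r); last by exists z.
by rewrite -separable_prod_XsubC -Dp separable_Xn_sub_1 // pnatr_eq0 -lt0n.
Qed.

Lemma diagonalizable_torsion k (g : 'M[F]_k.+1) n :
  (0 < n)%N -> g ^+ n = 1 -> diagonalizable g.
Proof.
move=> n_gt0 gn; have [z zP] := prim_root_exists n_gt0.
apply/diagonalizableP; exists [seq z ^+ i | i <- index_iota 0 n].
  rewrite map_inj_in_uniq ?iota_uniq // => i j; rewrite !mem_index_iota /= => i_n j_n.
  by move/eqP; rewrite (eq_prim_root_expr zP) !modn_small // => /eqP.
rewrite big_map (factor_Xn_sub_1 zP); apply: mxminpoly_min.
by rewrite rmorphB rmorphXn rmorph1 /= horner_mx_X gn subrr.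
Qed.

End Generalities.

Lemma char_poly_conj (K : comUnitRingType) n (x h : 'M[K]_n) : h \in unitmx ->
  char_poly (h *m x *m invmx h) = char_poly x.
Proof.
move=> hu; pose H := map_mx polyC h; pose Hi := map_mx polyC (invmx h).
have HHi : H *m Hi = 1%:M by rewrite -map_mxM mulmxV // map_mx1.
rewrite /char_poly.
have -> : char_poly_mx (h *m x *m invmx h) = H *m char_poly_mx x *m Hi.
  rewrite /char_poly_mx mulmxBr mulmxBl !map_mxM -/H -/Hi scalar_mxC.
  by rewrite -(mulmxA _ H) HHi mulmx1.
by rewrite !det_mulmx mulrAC -det_mulmx HHi det1 mul1r.
Qed.

Lemma invmx_mul (K : comUnitRingType) n (k l : 'M[K]_n) :
  k \in unitmx -> l \in unitmx -> invmx (k *m l) = invmx l *m invmx k.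
Proof.
move=> ku lu; have klu : k *m l \in unitmx by rewrite unitmx_mul ku.
have e : k *m l *m (invmx l *m invmx k) = 1%:M by rewrite mulmxA mulmxK // mulmxV.
by rewrite -[LHS]mulmx1 -e mulKmx.
Qed.

Lemma size_undup_map_in (T U : eqType) (f : T -> U) (s : seq T) :
  {in s &, injective f} -> size (undup (map f s)) = size (undup s).
Proof.
elim: s => //= x s IH fi; have fs : {in s &, injective f}.
  by move=> a b sa sb; apply: fi; rewrite inE ?sa ?sb orbT.
have -> : (f x \in map f s) = (x \in s).
  apply/mapP/idP => [[y sy] /fi ->|]; rewrite ?inE ?eqxx ?sy ?orbT //.
  by exists x.
by case: ifP => _ /=; rewrite IH.
Qed.

Lemma card_eq_uniq (T : choiceType) (s : seq T) :
  uniq s -> ([set` s] #= `I_(size s))%card.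
Proof.
case: s => [|x0 s]; first by rewrite set_nil II0.
set s' := x0 :: s => us.
have -> : [set` s'] = nth x0 s' @` `I_(size s').
  apply/seteqP; split=> [x /= xs|x /= [i iI <-]]; last by rewrite mem_nth.
  have xi : (index x s' < size s')%N by rewrite index_mem.
  by exists (index x s'); [exact: xi | exact: nth_index].
apply: inj_card_eq => i j /set_mem i_s /set_mem j_s.
exact: (uniqP x0 us).
Qed.

(** * The cross product of trace-zero octonions *)

Section Coordinates.
Variable F : numClosedFieldType.
Implicit Types (x y z c : 'rV[F]_7).

(** Indices are natural numbers so that the coordinates of an explicit vector
    reduce to entries of a list. *)
Definition crd x (k : nat) : F := x 0 (inord k).

Definition vec7 (s : seq F) : 'rV[F]_7 := \row_(i < 7) s`_i.

Lemma crd_vec7 s k : (k < 7)%N -> crd (vec7 s) k = s`_k.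
Proof. by move=> k7; rewrite /crd mxE inordK. Qed.

Lemma crdD x y k : crd (x + y) k = crd x k + crd y k.
Proof. by rewrite /crd mxE. Qed.
Lemma crdN x k : crd (- x) k = - crd x k.
Proof. by rewrite /crd mxE. Qed.
Lemma crdZ a x k : crd (a *: x) k = a * crd x k.
Proof. by rewrite /crd mxE. Qed.
Lemma crd0 k : crd 0 k = 0.
Proof. by rewrite /crd mxE. Qed.

Definition crdE := (crdD, crdN, crdZ, crd0).

Lemma rowP_crd x y : (forall k, (k < 7)%N -> crd x k = crd y k) -> x = y.
Proof.
by move=> e; apply/rowP => i; have := e i (ltn_ord i); rewrite /crd inord_val.
Qed.

End Coordinates.

Ltac coordinatewise := apply: rowP_crd; move=> [_|[_|[_|[_|[_|[_|[_|//]]]]]]].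

Section CrossProduct.
Variable F : numClosedFieldType.
Implicit Types (x y z c : 'rV[F]_7).

(** The scalar part of the product of two trace-zero octonions, i.e. half of its
    trace. *)
Definition beta x y : F :=
  crd x 0 * crd y 0 + (crd x 1 * crd y 4 + crd x 2 * crd y 5 + crd x 3 * crd y 6
   + crd x 4 * crd y 1 + crd x 5 * crd y 2 + crd x 6 * crd y 3) / 2.

(** The trace-zero part of the octonion product, i.e. half of the commutator;
    entries 0, 1-3 and 4-6 are the scalar and the two vector coordinates. *)
Definition cross x y : 'rV[F]_7 := vec7 [::
  (crd x 1 * crd y 4 + crd x 2 * crd y 5 + crd x 3 * crd y 6
   - crd x 4 * crd y 1 - crd x 5 * crd y 2 - crd x 6 * crd y 3) / 2;
  crd x 0 * crd y 1 - crd y 0 * crd x 1 - (crd x 5 * crd y 6 - crd x 6 * crd y 5);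
  crd x 0 * crd y 2 - crd y 0 * crd x 2 - (crd x 6 * crd y 4 - crd x 4 * crd y 6);
  crd x 0 * crd y 3 - crd y 0 * crd x 3 - (crd x 4 * crd y 5 - crd x 5 * crd y 4);
  crd y 0 * crd x 4 - crd x 0 * crd y 4 + (crd x 2 * crd y 3 - crd x 3 * crd y 2);
  crd y 0 * crd x 5 - crd x 0 * crd y 5 + (crd x 3 * crd y 1 - crd x 1 * crd y 3);
  crd y 0 * crd x 6 - crd x 0 * crd y 6 + (crd x 1 * crd y 2 - crd x 2 * crd y 1)].

Lemma betaC x y : beta x y = beta y x.
Proof. by rewrite /beta; field. Qed.
Lemma betaDl x y z : beta (x + y) z = beta x z + beta y z.
Proof. by rewrite /beta !crdE; field. Qed.
Lemma betaZl a x y : beta (a *: x) y = a * beta x y.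
Proof. by rewrite /beta !crdE; field. Qed.
Lemma betaDr x y z : beta x (y + z) = beta x y + beta x z.
Proof. by rewrite betaC betaDl !(betaC x). Qed.
Lemma betaZr a x y : beta x (a *: y) = a * beta x y.
Proof. by rewrite betaC betaZl betaC. Qed.
Lemma betaNl x y : beta (- x) y = - beta x y.
Proof. by rewrite -scaleN1r betaZl mulN1r. Qed.
Lemma betaNr x y : beta x (- y) = - beta x y.
Proof. by rewrite betaC betaNl betaC. Qed.
Lemma beta0l x : beta 0 x = 0.
Proof. by rewrite -(scale0r 0) betaZl mul0r. Qed.
Lemma beta0r x : beta x 0 = 0.
Proof. by rewrite betaC beta0l. Qed.

Lemma crossC x y : cross x y = - cross y x.
Proof. by coordinatewise; rewrite crdN !crd_vec7 //=; field. Qed.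
Lemma crossDl x y z : cross (x + y) z = cross x z + cross y z.
Proof. by coordinatewise; rewrite crdD !crd_vec7 //= !crdE; field. Qed.
Lemma crossZl a x y : cross (a *: x) y = a *: cross x y.
Proof. by coordinatewise; rewrite crdZ !crd_vec7 //= !crdE; field. Qed.
Lemma crossDr x y z : cross x (y + z) = cross x y + cross x z.
Proof. by rewrite crossC crossDl !(crossC x) opprD. Qed.
Lemma crossZr a x y : cross x (a *: y) = a *: cross x y.
Proof. by rewrite crossC crossZl (crossC x) scalerN. Qed.
Lemma crossNl x y : cross (- x) y = - cross x y.
Proof. by rewrite -scaleN1r crossZl scaleN1r. Qed.
Lemma crossNr x y : cross x (- y) = - cross x y.
Proof. by rewrite -scaleN1r crossZr scaleN1r. Qed.
Lemma cross0l x : cross 0 x = 0.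
Proof. by rewrite -(scale0r x) crossZl !scale0r. Qed.
Lemma cross0r x : cross x 0 = 0.
Proof. by rewrite crossC cross0l oppr0. Qed.
Lemma crossxx x : cross x x = 0.
Proof. by coordinatewise; rewrite crd0 !crd_vec7 //=; field. Qed.

(** Invariance of the 3-form beta(x × y, z) under cyclic permutations. *)
Lemma beta_cross x y z : beta (cross x y) z = beta x (cross y z).
Proof. by rewrite /beta !crd_vec7 //=; field. Qed.

(** Polarized form of x × (x × y) = beta(x, x) y - beta(x, y) x, which expresses
    that the octonions are alternative.  The multiplication table of a frame is
    derived from it. *)
Lemma crossA x y z : cross x (cross z y) + cross z (cross x y) =
  (2 * beta x z) *: y - beta x y *: z - beta z y *: x.
Proof. by coordinatewise; rewrite /beta !crdE !crd_vec7 //=; field. Qed.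

Lemma beta_nondeg x : (forall y, beta x y = 0) -> x = 0.
Proof.
move=> x0.
have t0 k (kP : (k < 7)%N) := x0 (vec7 [seq (i == k)%:R | i <- iota 0 7]).
(* Each coordinate is paired with its dual one. *)
coordinatewise; rewrite crd0; [have := t0 0 isT | have := t0 4 isT |
  have := t0 5 isT | have := t0 6 isT | have := t0 1 isT | have := t0 2 isT |
  have := t0 3 isT].
all: rewrite /beta !crd_vec7 //= !(mulr0, mulr1, addr0, add0r, mul0r) //.
all: by move/eqP; rewrite mulf_eq0 invr_eq0 pnatr_eq0 orbF => /eqP.
Qed.

Lemma beta_suml (I : Type) (r : seq I) (P : pred I) (E : I -> 'rV[F]_7) y :
  beta (\sum_(i <- r | P i) E i) y = \sum_(i <- r | P i) beta (E i) y.
Proof. by apply: (big_morph (beta^~ y)) => [u v|]; rewrite ?betaDl ?beta0l. Qed.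

Lemma cross_suml (I : Type) (r : seq I) (P : pred I) (E : I -> 'rV[F]_7) y :
  cross (\sum_(i <- r | P i) E i) y = \sum_(i <- r | P i) cross (E i) y.
Proof. by apply: (big_morph (cross^~ y)) => [u v|]; rewrite ?crossDl ?cross0l. Qed.

End CrossProduct.

(** * G2 as the automorphism group of the cross product *)

Section Automorphisms.
Variable F : numClosedFieldType.
Implicit Types (x y : 'rV[F]_7) (z w : octonion F) (g h : 'M[F]_7).

Definition cross_aut g :=
  (forall x y, beta (x *m g) (y *m g) = beta x y) /\
  (forall x y, cross (x *m g) (y *m g) = cross x y *m g).

Definition oct1 : octonion F := ((1 : F^o, 0), (0, 1 : F^o)).

Lemma oct_trace0E x : oct_trace0 x =
  ((crd x 0 : F^o, \row_i crd x i.+1), (\row_i crd x i.+4, - crd x 0 : F^o)).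
Proof.
have e i j : val j = i -> (i < 7)%N -> x 0 j = crd x i.
  by move=> <- _; rewrite /crd; congr (x 0 _); rewrite inord_val.
rewrite /oct_trace0; congr (_, _, (_, _)).
- by rewrite mxE (e 0%N).
- by apply/rowP => i; rewrite !mxE (e i.+1) //; have := ltn_ord i; lia.
- by apply/rowP => i; rewrite !mxE (e i.+4) //; have := ltn_ord i; lia.
- by rewrite mxE (e 0%N).
Qed.

(** Sums and case analysis over ['I_3] in terms of the ring elements 0, 1 and 2,
    since octonion products use addition modulo 3 on these indices. *)
Lemma sum3 (E : 'I_3 -> F) :
  \sum_i E i = E 0 + E 1 + E 2%:R.
Proof.
rewrite !big_ord_recl big_ord0 addr0 addrA.
by congr (E _ + E _ + E _); apply: val_inj.
Qed.

Lemma ord3P (P : 'I_3 -> Prop) : P 0 -> P 1 -> P 2%:R -> forall i, P i.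
Proof.
move=> P0 P1 P2 [[|[|[|//]]] i3].
- by rewrite (_ : Ordinal i3 = 0) //; apply: val_inj.
- by rewrite (_ : Ordinal i3 = 1) //; apply: val_inj.
- by rewrite (_ : Ordinal i3 = 2%:R) //; apply: val_inj.
Qed.

Lemma octP (w z : octonion F) : w.1.1 = z.1.1 -> w.1.2 = z.1.2 ->
  w.2.1 = z.2.1 -> w.2.2 = z.2.2 -> w = z.
Proof. by case: w z => [[? ?] [? ?]] [[? ?] [? ?]] /= -> -> -> ->. Qed.

Lemma oct_mul_trace0 x y : oct_mul (oct_trace0 x) (oct_trace0 y) =
  beta x y *: oct1 + oct_trace0 (cross x y).
Proof.
rewrite !oct_trace0E /=.
apply: octP => /=.
- by rewrite /dot3 sum3 !mxE /= !crd_vec7 //= /beta /GRing.scale /=; field.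
- by apply/rowP; apply: ord3P; rewrite !mxE /= !crd_vec7 //=; field.
- by apply/rowP; apply: ord3P; rewrite !mxE /= !crd_vec7 //=; field.
- by rewrite /dot3 sum3 !mxE /= !crd_vec7 //= /beta /GRing.scale /=; field.
Qed.

Lemma oct_mul1l (z : octonion F) : oct_mul oct1 z = z.
Proof.
case: z => [[a u] [v b]] /=; rewrite /dot3 !sum3 !mxE !mul0r mul1r.
apply: octP => /=; rewrite ?mul1r ?addr0 ?add0r //.
- by apply/rowP => i; rewrite !mxE; field.
- by apply/rowP => i; rewrite !mxE; field.
Qed.

Lemma oct_mul1r (z : octonion F) : oct_mul z oct1 = z.
Proof.
case: z => [[a u] [v b]] /=; rewrite /dot3 !sum3 !mxE !mulr0 mulr1.
apply: octP => /=; rewrite ?mulr1 ?addr0 ?add0r //.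
- by apply/rowP => i; rewrite !mxE; field.
- by apply/rowP => i; rewrite !mxE; field.
Qed.

Lemma oct_mulDl (w z t : octonion F) : oct_mul (w + z) t = oct_mul w t + oct_mul z t.
Proof.
case: w z t => [[a u] [v b]] [[c w] [z d]] [[e p] [q f]] /=.
apply: octP => /=.
- by rewrite /dot3 !sum3 !mxE; field.
- by apply/rowP => i; rewrite !mxE; field.
- by apply/rowP => i; rewrite !mxE; field.
- by rewrite /dot3 !sum3 !mxE; field.
Qed.

Lemma oct_mulDr (w z t : octonion F) : oct_mul t (w + z) = oct_mul t w + oct_mul t z.
Proof.
case: w z t => [[a u] [v b]] [[c w] [z d]] [[e p] [q f]] /=.
apply: octP => /=.
- by rewrite /dot3 !sum3 !mxE; field.
- by apply/rowP => i; rewrite !mxE; field.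
- by apply/rowP => i; rewrite !mxE; field.
- by rewrite /dot3 !sum3 !mxE; field.
Qed.

Lemma oct_mulZl a (w t : octonion F) : oct_mul (a *: w) t = a *: oct_mul w t.
Proof.
case: w t => [[b u] [v c]] [[e p] [q f]] /=.
apply: octP => /=.
- by rewrite /dot3 !sum3 !mxE /GRing.scale /=; field.
- by apply/rowP => i; rewrite !mxE /GRing.scale /=; field.
- by apply/rowP => i; rewrite !mxE /GRing.scale /=; field.
- by rewrite /dot3 !sum3 !mxE /GRing.scale /=; field.
Qed.

Lemma oct_mulZr a (w t : octonion F) : oct_mul t (a *: w) = a *: oct_mul t w.
Proof.
case: w t => [[b u] [v c]] [[e p] [q f]] /=.
apply: octP => /=.
- by rewrite /dot3 !sum3 !mxE /GRing.scale /=; field.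
- by apply/rowP => i; rewrite !mxE /GRing.scale /=; field.
- by apply/rowP => i; rewrite !mxE /GRing.scale /=; field.
- by rewrite /dot3 !sum3 !mxE /GRing.scale /=; field.
Qed.

(** [oct_re] and [oct_im] are the two components of the decomposition of the
    octonions into scalars and trace-zero octonions; [oct_of] is its inverse. *)
Definition oct_re (z : octonion F) : F := (z.1.1 + z.2.2) / 2.

Definition oct_im (z : octonion F) : 'rV[F]_7 := vec7 [::
  (z.1.1 - z.2.2) / 2; z.1.2 0 0; z.1.2 0 1; z.1.2 0 2%:R;
  z.2.1 0 0; z.2.1 0 1; z.2.1 0 2%:R].

Definition oct_of (s : F) x : octonion F := s *: oct1 + oct_trace0 x.

Lemma oct_ofK z : oct_of (oct_re z) (oct_im z) = z.
Proof.
rewrite /oct_of oct_trace0E; case: z => [[a u] [v b]]; apply: octP => /=.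
- by rewrite crd_vec7 //= /oct_re /GRing.scale /=; field.
- by apply/rowP; apply: ord3P; rewrite !mxE crd_vec7 //= mulr0 add0r.
- by apply/rowP; apply: ord3P; rewrite !mxE crd_vec7 //= mulr0 add0r.
- by rewrite crd_vec7 //= /oct_re /GRing.scale /=; field.
Qed.

Lemma oct_re_of s x : oct_re (oct_of s x) = s.
Proof. by rewrite /oct_of oct_trace0E /oct_re /= /GRing.scale /=; field. Qed.

Lemma oct_im_of s x : oct_im (oct_of s x) = x.
Proof.
rewrite /oct_of oct_trace0E; coordinatewise.
all: rewrite crd_vec7 //= /GRing.scale /= ?[in LHS]mxE ?[in LHS]mxE.
all: by rewrite ?mulr0 ?add0r //=; field.
Qed.

Lemma oct_reP a z w : oct_re (a *: z + w) = a * oct_re z + oct_re w.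
Proof. by rewrite /oct_re /= /GRing.scale /=; field. Qed.

Lemma oct_imP a z w : oct_im (a *: z + w) = a *: oct_im z + oct_im w.
Proof.
coordinatewise.
all: by rewrite crdD crdZ !crd_vec7 //= /GRing.scale /= ?mxE //; field.
Qed.

Lemma oct_ofP a s t x y :
  oct_of (a * s + t) (a *: x + y) = a *: oct_of s x + oct_of t y.
Proof.
rewrite -[RHS]oct_ofK; congr oct_of; first by rewrite oct_reP !oct_re_of.
by rewrite oct_imP !oct_im_of.
Qed.

Lemma oct_mul_of s t x y : oct_mul (oct_of s x) (oct_of t y) =
  oct_of (s * t + beta x y) (s *: y + t *: x + cross x y).
Proof.
have e0 : oct_trace0 0 = 0 :> octonion F.
  have := oct_imP (-1) 0 0; rewrite scaler0 addr0 scaleN1r addNr => e.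
  have r : oct_re 0 = 0 by rewrite /oct_re /= addr0 mul0r.
  by have := oct_ofK 0; rewrite e r /oct_of scale0r add0r.
have eD u v : oct_trace0 (u + v) = oct_trace0 u + oct_trace0 v :> octonion F.
  by have := oct_ofP 1 0 0 u v; rewrite /oct_of mulr0 addr0 !scale1r scale0r !add0r.
have eZ a u : oct_trace0 (a *: u) = a *: oct_trace0 u :> octonion F.
  by have := oct_ofP a 0 0 u 0; rewrite /oct_of mulr0 addr0 e0 addr0 !scale0r !add0r addr0.
rewrite /oct_of oct_mulDl !oct_mulDr !oct_mulZl !oct_mulZr.
rewrite !(oct_mul1l, oct_mul1r) oct_mul_trace0 !eD !eZ scalerA scalerDl.
by rewrite -!addrA; congr (_ + _); rewrite [in RHS]addrC !addrA addrAC.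
Qed.

(** A vector killed by g would be orthogonal to everything. *)
Lemma cross_aut_unit g : (forall x y, beta (x *m g) (y *m g) = beta x y) -> g \in unitmx.
Proof.
move=> gb; rewrite -row_free_unit; apply: inj_row_free => v v0.
by apply: beta_nondeg => y; rewrite -gb v0 beta0l.
Qed.

Lemma cross_autM g h : cross_aut g -> cross_aut h -> cross_aut (g *m h).
Proof.
by move=> [gb gc] [hb hc]; split=> x y; rewrite !mulmxA ?hb ?hc ?gb ?gc.
Qed.

Lemma cross_aut1 : cross_aut 1%:M.
Proof. by split=> x y; rewrite !mulmx1. Qed.

Lemma cross_autV g : cross_aut g -> cross_aut (invmx g).
Proof.
move=> [gb gc]; have gu := cross_aut_unit gb.
split=> x y; first by rewrite -gb !mulmxKV.
by rewrite -[LHS](mulmxK gu) -gc !mulmxKV.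
Qed.

(** An octonion automorphism fixes the unit, so it is determined by its matrix g
    on the trace-zero part, and comparing the scalar and trace-zero parts of
    products shows that g preserves [beta] and [cross].  Conversely such a g
    extends by the identity on scalars. *)
Lemma G2E g : G2 F g <-> cross_aut g.
Proof.
split.
- move=> [f [flin [fi fK fiK] fM] fg].
  have f1 : f oct1 = oct1.
    by rewrite -[LHS]oct_mul1r -{2}[oct1]fiK -fM oct_mul1l fiK.
  have fof s x : f (oct_of s x) = oct_of s (x *m g) by rewrite flin f1 fg.
  have of0 x : oct_trace0 x = oct_of 0 x by rewrite /oct_of scale0r add0r.
  have E x y : oct_of (beta x y) (cross x y *m g) =
               oct_of (beta (x *m g) (y *m g)) (cross (x *m g) (y *m g)).
    by rewrite -fof /oct_of -!oct_mul_trace0 fM !fg.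
  split=> x y; first by have := congr1 oct_re (E x y); rewrite !oct_re_of => ->.
  by have := congr1 oct_im (E x y); rewrite !oct_im_of => ->.
- move=> ga; have gu := cross_aut_unit ga.1.
  pose f g (z : octonion F) := oct_of (oct_re z) (oct_im z *m g).
  exists (f g); last first.
    move=> x; rewrite /f.
    have -> : oct_trace0 x = oct_of 0 x by rewrite /oct_of scale0r add0r.
    by rewrite oct_re_of oct_im_of /oct_of scale0r add0r.
  split.
  + by move=> a z w; rewrite /f oct_reP oct_imP mulmxDl -scalemxAl oct_ofP.
  + exists (f (invmx g)) => z; rewrite /f !(oct_re_of, oct_im_of).
      by rewrite mulmxK // oct_ofK.
    by rewrite mulmxKV // oct_ofK.
  + move=> z w; rewrite -{1}[z]oct_ofK -{1}[w]oct_ofK oct_mul_of /f.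
    rewrite !(oct_re_of, oct_im_of) oct_mul_of ga.1 ga.2.
    by rewrite !mulmxDl -!scalemxAl.
Qed.

End Automorphisms.

(** * Frames *)

Section Frames.
Variable F : numClosedFieldType.
Implicit Types (x y z c u v w : 'rV[F]_7) (g h : 'M[F]_7).

Section Polarization.
Variable c : 'rV[F]_7.

(** The eigenspaces of c × _ for 1 and -1.  When beta(c, c) = 1 these are the two
    off-diagonal Peirce components of the idempotents (1 + c)/2 and (1 - c)/2. *)
Definition pos x := cross c x = x.
Definition neg x := cross c x = - x.

Lemma beta_axis_pos x : pos x -> beta c x = 0.
Proof. by move=> <-; rewrite -beta_cross crossxx beta0l. Qed.

Lemma beta_axis_neg x : neg x -> beta c x = 0.
Proof. by move=> xn; rewrite -[x]opprK -xn betaNr -beta_cross crossxx beta0l oppr0. Qed.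

(** Moving c across the invariant 3-form changes the sign: beta(x, y) =
    beta(c × x, y) = - beta(x, c × y) = - beta(x, y). *)
Lemma beta_pos x y : pos x -> pos y -> beta x y = 0.
Proof.
move=> xp yp; apply: (@eq_opp0 F F^o); rewrite -{1}xp crossC betaNl.
by rewrite beta_cross yp.
Qed.

Lemma beta_neg x y : neg x -> neg y -> beta x y = 0.
Proof.
move=> xn yn; apply: (@eq_opp0 F F^o).
rewrite -{1}[x]opprK -xn crossC opprK.
by rewrite beta_cross yn betaNr.
Qed.

Lemma cross_pos_neg x y : pos x -> pos y -> neg (cross x y).
Proof.
move=> xp yp; have := crossA c y x; rewrite yp (beta_pos xp yp).
rewrite !beta_axis_pos // mulr0 !scale0r !subr0 => /eqP.
by rewrite addr_eq0 => /eqP.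
Qed.

(** Applying [crossA] to (c, v, y) and to (c, y, v) gives two equations for
    c × (y × v); together they force it to vanish, and y × v is left as a
    multiple of c. *)
Lemma cross_pos_axis y v : pos y -> neg v -> cross y v = beta y v *: c.
Proof.
move=> yp vn; set q := cross y v.
have e1 : cross c q - q = - (beta y v *: c).
  have := crossA c v y; rewrite vn crossNr (beta_axis_pos yp) (beta_axis_neg vn).
  by rewrite mulr0 !scale0r subr0 sub0r.
have e2 : - cross c q - q = - (beta y v *: c).
  have := crossA c y v; rewrite yp (crossC v) -/q crossNr.
  rewrite (beta_axis_pos yp) (beta_axis_neg vn) (betaC v).
  by rewrite mulr0 !scale0r subr0 sub0r.
have e3 : cross c q = 0 by apply: eq_opp0; apply: (addIr (- q)); rewrite e1.
by move: e1; rewrite e3 sub0r => /oppr_inj.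
Qed.

End Polarization.

(** The images of the standard basis vectors of the scalar coordinate and of the
    first vector coordinate under an element of G2 satisfy these relations;
    [frame_cross_aut] is the converse. *)
Definition frame c u1 u2 u3 :=
  [/\ beta c c = 1, [/\ pos c u1, pos c u2 & pos c u3]
    & beta (cross u1 u2) u3 = 2^-1].

(** Cyclic symmetry of the definition; it divides the work on the multiplication
    table by three. *)
Lemma frame_rot c u1 u2 u3 : frame c u1 u2 u3 -> frame c u2 u3 u1.
Proof. by move=> [c1 [p1 p2 p3] e]; split=> //; rewrite betaC -beta_cross. Qed.

(** The rows u2 × u3, u3 × u1, u1 × u2 complete a frame to a basis. *)
Definition frame_mx c u1 u2 u3 : 'M[F]_7 :=
  \matrix_(i < 7) [:: c; u1; u2; u3; cross u2 u3; cross u3 u1; cross u1 u2]`_i.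

Lemma mul_frame_mx x c u1 u2 u3 : x *m frame_mx c u1 u2 u3 =
  crd x 0 *: c + crd x 1 *: u1 + crd x 2 *: u2 + crd x 3 *: u3 +
  crd x 4 *: cross u2 u3 + crd x 5 *: cross u3 u1 + crd x 6 *: cross u1 u2.
Proof.
have e i : x 0 i = crd x i by rewrite /crd inord_val.
rewrite mulmx_sum_row !big_ord_recl big_ord0 addr0 !addrA.
by rewrite !e /= !rowK.
Qed.

Section FrameTable.
Variables c u1 u2 u3 : 'rV[F]_7.
Hypothesis fr : frame c u1 u2 u3.

Lemma frame_beta : [/\ beta u1 (cross u2 u3) = 2^-1,
   beta u1 (cross u3 u1) = 0 & beta u1 (cross u1 u2) = 0].
Proof.
case: fr => c1 _ e; split; first by rewrite -beta_cross.
  by rewrite betaC beta_cross crossxx beta0r.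
by rewrite -beta_cross crossxx beta0l.
Qed.

Lemma frame_cross_pos_neg : [/\ cross u1 (cross u2 u3) = 2^-1 *: c,
   cross u1 (cross u3 u1) = 0 & cross u1 (cross u1 u2) = 0].
Proof.
case: frame_beta => b1 b2 b3; case: fr => c1 [p1 p2 p3] _.
have pn x y : pos c x -> pos c y -> neg c (cross x y) by exact: cross_pos_neg.
split.
- by rewrite (cross_pos_axis p1 (pn _ _ p2 p3)) b1.
- by rewrite (cross_pos_axis p1 (pn _ _ p3 p1)) b2 scale0r.
- by rewrite (cross_pos_axis p1 (pn _ _ p1 p2)) b3 scale0r.
Qed.

(** [crossA] for w = u1 × u2 and the product u2 × u3, where w × u3 is already
    known to be a multiple of c. *)
Lemma frame_cross_neg : cross (cross u1 u2) (cross u2 u3) = - u2.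
Proof.
case: frame_beta => b1 _ _; case: fr => c1 [p1 p2 p3] e.
set w := cross u1 u2.
have wn : neg c w by apply: cross_pos_neg.
have := crossA w u3 u2.
have -> : cross w u3 = - (2^-1 *: c).
  by rewrite crossC (cross_pos_axis p3 wn) betaC e.
have -> : beta w u2 = 0 by rewrite beta_cross crossxx beta0r.
rewrite (beta_pos p2 p3) e crossNr crossZr (crossC u2 c) p2 mulr0 !scale0r.
rewrite subr0 sub0r scalerN opprK => /(canRL (addrK _)) ->.
rewrite -opprD -scalerDl (_ : 2^-1 + 2^-1 = 1) ?scale1r //; by field.
Qed.

End FrameTable.

Lemma frame_table c u1 u2 u3 : frame c u1 u2 u3 ->
  let v1 := cross u2 u3 in let v2 := cross u3 u1 in let v3 := cross u1 u2 in
  [/\ [/\ cross c u1 = u1, cross c v1 = - v1, cross u1 v1 = 2^-1 *: c,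
          cross u1 v2 = 0 & cross u1 v3 = 0],
   cross v3 v1 = - u2, beta c u1 = 0, beta c v1 = 0 &
   [/\ beta u1 u1 = 0, beta u1 u2 = 0, beta u1 u3 = 0,
    [/\ beta v1 v1 = 0, beta v1 v2 = 0 & beta v1 v3 = 0] &
    [/\ beta u1 v1 = 2^-1, beta u1 v2 = 0 & beta u1 v3 = 0]]].
Proof.
move=> fr v1 v2 v3.
case: (fr) => c1 [p1 p2 p3] e.
have pn x y : pos c x -> pos c y -> neg c (cross x y) by exact: cross_pos_neg.
have n1 : neg c v1 by apply: pn.
have n2 : neg c v2 by apply: pn.
have n3 : neg c v3 by apply: pn.
case: (frame_cross_pos_neg fr) => ? ? ?; case: (frame_beta fr) => ? ? ?.
do !split=> //; rewrite ?(beta_axis_pos p1, beta_axis_neg n1) //.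
all: try by apply: (@beta_pos c).
all: try by apply: (@beta_neg c).
exact: (frame_cross_neg fr).
Qed.

(** The rows have the multiplication table and the Gram matrix of the standard
    basis, so both operations are preserved by bilinearity. *)
Lemma frame_cross_aut c u1 u2 u3 :
  frame c u1 u2 u3 -> cross_aut (frame_mx c u1 u2 u3).
Proof.
move=> f1; have f2 := frame_rot f1; have f3 := frame_rot f2.
have c1 : beta c c = 1 by case: f1.
have /= := frame_table f1; have /= := frame_table f2; have /= := frame_table f3.
set v1 := cross u2 u3; set v2 := cross u3 u1; set v3 := cross u1 u2.
case=> [] [t31 t32 t33 t34 t35] t36 b31 b32 [b33 b34 b35 [b36 b37 b38] [b39 b3a b3b]].
case=> [] [t21 t22 t23 t24 t25] t26 b21 b22 [b23 b24 b25 [b26 b27 b28] [b29 b2a b2b]].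
case=> [] [t11 t12 t13 t14 t15] t16 b11 b12 [b13 b14 b15 [b16 b17 b18] [b19 b1a b1b]].
have T := (t11, t12, t13, t14, t15, t16, t21, t22, t23, t24, t25, t26,
           t31, t32, t33, t34, t35, t36, crossxx).
have T' := (crossC u1 c, crossC u2 c, crossC u3 c, crossC v1 c, crossC v2 c, crossC v3 c,
  crossC u2 u1, crossC u3 u2, crossC u1 u3,
  (crossC v1 u1, crossC v1 u2, crossC v1 u3, crossC v2 u1, crossC v2 u2, crossC v2 u3,
  crossC v3 u1, crossC v3 u2, crossC v3 u3, crossC v1 v3, crossC v2 v1, crossC v3 v2)).
have B := (b11, b12, b13, b14, b15, b16, b17, b18, b19, b1a, b1b,
  (b21, b22, b23, b24, b25, b26, b27, b28, b29, b2a, b2b),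
  (b31, b32, b33, b34, b35, b36, b37, b38, b39, b3a, b3b), c1).
have B' := (betaC u1 c, betaC u2 c, betaC u3 c, betaC v1 c, betaC v2 c, betaC v3 c,
  (betaC v1 u1, betaC v1 u2, betaC v1 u3, betaC v2 u1, betaC v2 u2, betaC v2 u3,
  betaC v3 u1, betaC v3 u2, betaC v3 u3)).
split=> x y; rewrite !mul_frame_mx -/v1 -/v2 -/v3.
  rewrite !(betaDl, betaDr, betaZl, betaZr) !B' !B /beta.
  by move: (crd x) (crd y) => a b; field.
rewrite !(crossDl, crossDr, crossZl, crossZr) !T' -/v1 -/v2 -/v3 !T.
clearbody v1 v2 v3; apply: rowP_crd => k _; rewrite !crdE !crd_vec7 //=.
move: (crd x) (crd y) (crd c k) (crd u1 k) (crd u2 k) (crd u3 k).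
move: (crd v1 k) (crd v2 k) (crd v3 k).
by move=> *; field.
Qed.

End Frames.

(** * Eigenvalues in a frame and the Weyl group *)

Section Weights.
Variable F : numClosedFieldType.
Implicit Types (x y z c u v w : 'rV[F]_7) (g h : 'M[F]_7) (t : F).

(** The weights of the 7-dimensional representation are 0 and the short roots;
    t2 t3, t3 t1 and t1 t2 are the inverses of t1, t2 and t3 when t1 t2 t3 = 1. *)
Definition torus t1 t2 t3 : 'M[F]_7 :=
  diag_mx (vec7 [:: 1; t1; t2; t3; t2 * t3; t3 * t1; t1 * t2]).

(** The eigenvalues are kept as an ordered triple because they depend on the
    frame: the next lemmas change the frame and thereby make the Weyl group act
    on the triples of a fixed g. *)
Definition weights g t1 t2 t3 := exists c u1 u2 u3, frame c u1 u2 u3 /\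
  [/\ c *m g = c, u1 *m g = t1 *: u1, u2 *m g = t2 *: u2 & u3 *m g = t3 *: u3].

Lemma weights_rot g t1 t2 t3 : weights g t1 t2 t3 -> weights g t2 t3 t1.
Proof.
by move=> [c [u1 [u2 [u3 [/frame_rot fr [*]]]]]]; exists c, u2, u3, u1; split.
Qed.

(** The sign of u3 keeps beta(u1 × u2, u3) = 1/2 after an exchange of u1 and u2. *)
Lemma weights_swap g t1 t2 t3 : weights g t1 t2 t3 -> weights g t2 t1 t3.
Proof.
move=> [c [u1 [u2 [u3 [[c1 [p1 p2 p3] e] [gc g1 g2 g3]]]]]].
exists c, u2, u1, (- u3); split; last by rewrite mulNmx g3 scalerN.
split=> //; first by split; rewrite // /pos crossNr p3.
by rewrite crossC betaNl betaNr opprK.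
Qed.

(** The number beta(u1 × u2, u3) = 1/2 is multiplied by t1 t2 t3 under g. *)
Lemma weights_prod g t1 t2 t3 : cross_aut g -> weights g t1 t2 t3 ->
  t1 * t2 * t3 = 1.
Proof.
move=> [gb gc] [c [u1 [u2 [u3 [[_ _ e] [_ g1 g2 g3]]]]]].
have := gb (cross u1 u2) u3; rewrite -gc g1 g2 g3.
rewrite crossZl crossZr !betaZl betaZr e !mulrA => /(canRL (mulfK (half_neq0 F))) ->.
by rewrite divff ?half_neq0.
Qed.

(** For the axis -c the two eigenspaces exchange their roles, and the vectors
    u2 × u3, u3 × u1, - u1 × u2 form a frame. *)
Lemma weights_inv g t1 t2 t3 : cross_aut g -> weights g t1 t2 t3 ->
  weights g t1^-1 t2^-1 t3^-1.
Proof.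
move=> ga gw; have t1P := weights_prod ga gw.
case: gw => [c [u1 [u2 [u3 [f1 [gc g1 g2 g3]]]]]].
have f2 := frame_rot f1; have f3 := frame_rot f2.
have [[_ n1 _ _ _] _ _ _ _] := frame_table f1.
have [[_ n2 _ _ _] _ _ _ _] := frame_table f2.
have [[_ n3 _ _ _] e3 _ _ [_ _ _ _ [b3 _ _]]] := frame_table f3.
have eV (a b d : F) : a * b * d = 1 -> a * b = d^-1.
  move=> abd; have d0 : d != 0.
    by apply: contra_eq_neq abd => ->; rewrite mulr0 eq_sym oner_neq0.
  by apply: (mulIf d0); rewrite mulVf.
(* The eigenvalue t2 t3 of u2 × u3 is the inverse of t1. *)
exists (- c), (cross u2 u3), (cross u3 u1), (- cross u1 u2); split.
- split.
  + by rewrite betaNl betaNr opprK; case: f1.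
  + by split; rewrite /pos crossNl ?crossNr ?n1 ?n2 ?n3 opprK.
  + have [_ -> _ _ _] := frame_table f2.
    by rewrite betaNl betaNr opprK.
- have gX := ga.2; split; first by rewrite mulNmx gc.
  + by rewrite -gX g2 g3 crossZl crossZr scalerA (eV _ _ t1) // mulrC mulrA.
  + by rewrite -gX g3 g1 crossZl crossZr scalerA (eV _ _ t2) // -mulrA mulrC.
  + by rewrite mulNmx -gX g1 g2 crossZl crossZr scalerA (eV _ _ t3) // scalerN.
Qed.

Lemma weights_conj g t1 t2 t3 : cross_aut g -> weights g t1 t2 t3 ->
  exists2 h, cross_aut h & h *m g *m invmx h = torus t1 t2 t3.
Proof.
move=> [gb gX] [c [u1 [u2 [u3 [fr [gc g1 g2 g3]]]]]].
have ha := frame_cross_aut fr; exists (frame_mx c u1 u2 u3) => //.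
apply: (canLR (mulmxK (cross_aut_unit ha.1))).
apply/row_matrixP => i; rewrite !row_mul row_diag_mx -scalemxAl -rowE !rowK mxE.
case: i => [[|[|[|[|[|[|[|//]]]]]]] _] /=; rewrite ?scale1r //.
- by rewrite -gX g2 g3 crossZl crossZr scalerA.
- by rewrite -gX g3 g1 crossZl crossZr scalerA.
- by rewrite -gX g1 g2 crossZl crossZr scalerA.
Qed.

Lemma crd_torus x t1 t2 t3 k : (k < 7)%N -> crd (x *m torus t1 t2 t3) k =
  [:: 1; t1; t2; t3; t2 * t3; t3 * t1; t1 * t2]`_k * crd x k.
Proof. by move=> k7; rewrite /crd mul_mx_diag !mxE inordK // mulrC. Qed.

Lemma torus_aut t1 t2 t3 : t1 * t2 * t3 = 1 -> cross_aut (torus t1 t2 t3).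
Proof.
move=> e; split=> x y.
  by rewrite /beta !crd_torus //=; ring: e.
coordinatewise.
all: by rewrite crd_torus // !crd_vec7 //= !crd_torus //=; ring: e.
Qed.

End Weights.

(** * The operator of multiplication by an axis *)

Section Diagonalization.
Variable F : numClosedFieldType.
Implicit Types (x y z c u v w : 'rV[F]_7) (g h : 'M[F]_7) (t : F).

(** The matrix of c × _, acting on row vectors. *)
Definition ad c : 'M[F]_7 := \matrix_(i < 7) cross c (delta_mx 0 i).

Lemma mul_ad x c : x *m ad c = cross c x.
Proof.
rewrite mulmx_sum_row [in RHS](row_sum_delta x) crossC cross_suml -sumrN.
by apply: eq_bigr => i _; rewrite rowK crossZl -scalerN -crossC.
Qed.

Lemma cross_axis c x : beta c c = 1 -> cross c (cross c x) = x - beta c x *: c.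
Proof.
move=> c1; have := crossA c x c; rewrite c1 mulr1 => e.
apply: (scalerI (_ : (2 : F) != 0)); first by rewrite pnatr_eq0.
rewrite scaler_nat mulr2n e scalerBr -addrA -opprD -scalerDl scalerA.
by congr (_ - _ *: _); rewrite mulr_natl.
Qed.

Lemma ad_cubed c : beta c c = 1 -> ad c *m ad c *m ad c = ad c.
Proof.
move=> c1; apply/row_matrixP => i; rewrite !rowE !mulmxA !mul_ad.
rewrite -[in LHS](mul_ad _ c) !mul_ad cross_axis // -beta_cross crossxx beta0l.
by rewrite scale0r subr0.
Qed.

(** The operator is annihilated by X (X - 1) (X + 1). *)
Lemma diagonalizable_ad c : beta c c = 1 -> diagonalizable (ad c).
Proof.
move=> c1; apply/diagonalizableP; exists [:: 0; 1; -1].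
  rewrite /= !inE negb_or !(eq_sym 0) oppr_eq0 oner_neq0 /= andbT.
  by rewrite -addr_eq0 -[1 + 1]/(2%:R) pnatr_eq0.
apply: mxminpoly_min; rewrite !big_cons big_nil mulr1.
rewrite !rmorphM !rmorphB /= !horner_mx_X !horner_mx_C.
rewrite raddf0 subr0 -[(-1)%:M]/((-1)%:M) raddfN opprK mulrA mulrBr mulrDr.
rewrite mulrBl -[1%:M]/(1 : 'M_7) !mulr1.
have := ad_cubed c1; rewrite -[_ *m _ *m _]/(ad c * ad c * ad c) => ->.
by rewrite addrA subrK subrr.
Qed.

(** This trace and the next one give the multiplicities of the eigenvalues 1 and
    -1 of c × _: their difference is 0 and their sum is 6. *)
Lemma tr_ad c : \tr (ad c) = 0.
Proof.
have adE i : ad c i i = crd (cross c (delta_mx 0 i)) i.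
  by rewrite mxE /crd inord_val.
have dE (i : 'I_7) (k : nat) : (k < 7)%N -> crd (delta_mx 0 i : 'rV[F]_7) k = (k == i)%:R.
  by move=> k7; rewrite /crd mxE eqxx /= -val_eqE /= inordK.
rewrite /mxtrace !big_ord_recl big_ord0 !adE !crd_vec7 //= !dE //=.
by rewrite !(mulr0, mulr1, subr0, addr0, add0r, mul0r, mul1r, sub0r); field.
Qed.

Lemma tr_ad2 c : beta c c = 1 -> \tr (ad c *m ad c) = 6.
Proof.
move=> c1.
have adE i : (ad c *m ad c) i i = 1 - beta c (c 0 i *: delta_mx 0 i).
  transitivity (row i (ad c *m ad c) 0 i); first by rewrite [RHS]mxE.
  rewrite rowE mulmxA !mul_ad cross_axis // betaZr !mxE !eqxx /=.
  by rewrite [c _ _ * _]mulrC.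
rewrite /mxtrace (eq_bigr _ (fun i _ => adE i)) sumrB.
rewrite sumr_const card_ord; under [X in _ - X]eq_bigr do rewrite betaC.
rewrite -beta_suml -row_sum_delta c1.
by rewrite -[1 in X in _ - X]/(1%:R) -natrB.
Qed.

End Diagonalization.

(** * Frames of eigenvectors *)

Section EigenFrame.
Variable F : numClosedFieldType.
Implicit Types (x y z c u v w : 'rV[F]_7) (g h : 'M[F]_7) (t : F).

Lemma ad_comm g c : cross_aut g -> c *m g = c -> g *m ad c = ad c *m g.
Proof.
move=> [_ gX] gc; apply/row_matrixP => i.
by rewrite !rowE !mulmxA !mul_ad -gX gc.
Qed.

(** Since g fixes c it commutes with c × _, and both are diagonalizable. *)
Lemma joint_eigenbasis g c n : (0 < n)%N -> g ^+ n = 1 -> cross_aut g ->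
  beta c c = 1 -> c *m g = c ->
  exists2 P : 'M[F]_7, P \in unitmx & exists a d : 'rV[F]_7,
    P *m g = diag_mx a *m P /\ P *m ad c = diag_mx d *m P.
Proof.
move=> n_gt0 gn ga c1 gc.
have comm_gc := ad_comm ga gc.
have [P Pu /= /and3P[Pg Pc _]] : codiagonalizable [:: g; ad c].
  apply/codiagonalizableP; split=> [A B | A]; rewrite !inE.
    by move=> /orP[] /eqP -> /orP[] /eqP ->; rewrite /comm_mx.
  by move=> /orP[] /eqP ->; [exact: diagonalizable_torsion gn | exact: diagonalizable_ad].
have [a /(simmxP Pu) Pa] := diagonalizable_forPex Pg.
have [d /(simmxP Pu) Pd] := diagonalizable_forPex Pc.
by exists P => //; exists a, d.
Qed.

(** In a common eigenbasis of g and c × _, exactly three vectors u1, u2, u3 have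
    eigenvalue 1 for c × _, because of the traces of c × _ and of its square.  It
    remains to see that beta(u1 × u2, u3) does not vanish, and to rescale. *)
Lemma eigenframe_exists g c n : (0 < n)%N -> g ^+ n = 1 -> cross_aut g ->
  beta c c = 1 -> c *m g = c ->
  exists u1 u2 u3 t1 t2 t3, frame c u1 u2 u3 /\
    [/\ u1 *m g = t1 *: u1, u2 *m g = t2 *: u2 & u3 *m g = t3 *: u3].
Proof.
move=> n_gt0 gn ga c1 gc.
have [P Pu [a [d [Pg Pc]]]] := joint_eigenbasis n_gt0 gn ga c1 gc.
pose p i := row i P.
have pg i : p i *m g = a 0 i *: p i.
  by rewrite /p -row_mul Pg row_mul row_diag_mx -scalemxAl -rowE.
have pc i : cross c (p i) = d 0 i *: p i.
  by rewrite -mul_ad /p -row_mul Pc row_mul row_diag_mx -scalemxAl -rowE.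
have p_inj u v : u *m P = v *m P -> u = v.
  by move=> /(congr1 (mulmx^~ (invmx P))); rewrite !mulmxK.
have pE i : p i = delta_mx 0 i *m P by rewrite /p rowE.
have p_neq0 i : p i != 0.
  apply/eqP; rewrite pE -[0 in RHS](mul0mx _ P) => /p_inj/rowP/(_ i).
  by rewrite !mxE !eqxx => /eqP; rewrite oner_eq0.
have p_perp v : (forall i, beta v (p i) = 0) -> v = 0.
  move=> v0; apply: beta_nondeg => y.
  have -> : y = y *m invmx P *m P by rewrite mulmxKV.
  rewrite mulmx_sum_row betaC beta_suml big1 // => i _.
  by rewrite betaZl betaC v0 mulr0.
have dE : ad c = invmx P *m diag_mx d *m P by rewrite -mulmxA -Pc mulKmx.
have d3 i : d 0 i ^+ 3 = d 0 i.
  have /(congr1 (mulmx (p i))) := ad_cubed c1.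
  rewrite !mulmxA !mul_ad !(pc, crossZr) !scalerA -!expr2 -exprSr.
  move/eqP; rewrite -subr_eq0 -scalerBl scaler_eq0 (negPf (p_neq0 i)) orbF.
  by rewrite subr_eq0 => /eqP.
have d01 i : [\/ d 0 i = 0, d 0 i = 1 | d 0 i = -1].
  have /eqP := d3 i; rewrite -subr_eq0.
  rewrite (_ : _ - _ = d 0 i * (d 0 i - 1) * (d 0 i + 1)); last by ring.
  rewrite !mulf_eq0 subr_eq0 addr_eq0 -orbA => /or3P[] /eqP ->.
  - exact: Or31.
  - exact: Or32.
  - exact: Or33.
have sum_d : \sum_i d 0 i = 0.
  rewrite -mxtrace_diag -(tr_ad c) dE mxtrace_mulC mulmxA mulmxV // mul1mx //.
have sum_d2 : \sum_i d 0 i ^+ 2 = 6.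
  have d2E : ad c *m ad c = invmx P *m (diag_mx d *m diag_mx d) *m P.
    by rewrite dE !mulmxA mulmxK.
  rewrite -(tr_ad2 c1) d2E mxtrace_mulC mulmxA mulmxV // mul1mx mulmx_diag mxtrace_diag.
  by apply: eq_bigr => i _; rewrite mxE expr2.
(* The sum of d^2 + d counts the eigenvalue 1 twice and kills 0 and -1. *)
pose A := [set i | d 0 i == 1]%SET.
have cardA : #|A| = 3%N.
  have two0 : (2 : F) != 0 by rewrite pnatr_eq0.
  have s6 : 2 * (\sum_i (d 0 i == 1)%:R) = 6 :> F.
    rewrite mulr_sumr -sum_d2 -[RHS]addr0 -[X in _ = _ + X]sum_d -big_split /=.
    apply: eq_bigr => i _; case: (d01 i) => ->.
    - by rewrite eq_sym oner_eq0 expr0n addr0 mulr0.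
    - by rewrite eqxx expr1n mulr1.
    - by rewrite sqrrN expr1n subrr eq_sym -addr_eq0 -[1 + 1]/(2%:R) pnatr_eq0 mulr0.
  apply/eqP; rewrite -(eqr_nat F); apply/eqP/(mulfI two0).
  rewrite -[2 * 3%:R]natrM -[(2 * 3)%:R]/(6%:R : F) -s6 -sum1_card natr_sum big_mkcond /=.
  by congr (_ * _); apply: eq_bigr => i _; rewrite inE; case: eqP.
have [i [j [k [ij Aijk]]]] : exists i j k, i != j /\ A =i [:: i; j; k].
  have := cardA; rewrite cardE; have := enum_uniq (mem A); have := mem_enum (mem A).
  case: (enum _) => [|i [|j [|k [|//]]]] //= e /andP[]; rewrite inE negb_or.
  by move=> /andP[ij _] _ _; exists i, j, k; split => // l; rewrite -e.
have ppos l : l \in A -> pos c (p l).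
  by rewrite inE => /eqP dl; rewrite /pos pc dl scale1r.
have [Ai Aj Ak] : [/\ i \in A, j \in A & k \in A].
  by rewrite !Aijk !inE !eqxx !orbT.
have paxis l : d 0 l = 0 -> p l = beta c (p l) *: c.
  move=> dl; have := cross_axis (p l) c1; rewrite !(pc, crossZr) dl !scale0r.
  by move/esym/eqP; rewrite subr_eq0 => /eqP.
have pneg l : d 0 l = -1 -> neg c (p l) by move=> dl; rewrite /neg pc dl scaleN1r.
set v := cross (p i) (p j).
have vn : neg c v by apply: cross_pos_neg; apply: ppos.
have w0 : beta v (p k) != 0.
  apply/eqP => vk0.
  (* u1 × u2 is orthogonal to c, to u1, u2 and to the eigenspace of -1. *)
  have v0 : v = 0.
    apply: p_perp => l; case: (d01 l) => dl.
    - by rewrite paxis // betaZr (betaC v c) (beta_axis_neg vn) mulr0.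
    - have : l \in A by rewrite inE dl.
      rewrite Aijk !inE => /or3P[] /eqP -> //.
        by rewrite betaC -beta_cross crossxx beta0l.
      by rewrite beta_cross crossxx beta0r.
    - by apply: (beta_neg vn); apply: pneg.
  (* If u1 × u2 = 0, pair u1 with some w in the eigenspace of -1; then [crossA]
     makes u1 and u2 proportional. *)
  have [l il0] : exists l, beta (p i) (p l) != 0.
    apply/existsP; apply: contraTT (p_neq0 i); rewrite negb_exists negbK => /forallP pi0.
    by apply/eqP/p_perp => l; apply/eqP; rewrite -[_ == _]negbK pi0.
  have ln : neg c (p l).
    case: (d01 l) => dl; last exact: pneg.
    - move: il0; rewrite (paxis _ dl) betaZr (betaC _ c) (beta_axis_pos (ppos _ Ai)).
      by rewrite mulr0 eqxx.
    - have lp : pos c (p l) by apply: ppos; rewrite inE dl.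
      by move: il0; rewrite (beta_pos (ppos _ Ai) lp) eqxx.
  have := crossA (p l) (p j) (p i); rewrite -/v v0 cross0r add0r.
  rewrite (crossC (p l)) (cross_pos_axis (ppos _ Aj) ln) crossNr crossZr.
  rewrite (crossC (p i) c) (ppos _ Ai : cross c (p i) = p i).
  rewrite (beta_pos (ppos _ Ai) (ppos _ Aj)) scale0r subr0.
  rewrite scalerN opprK (betaC (p l) (p j)) => /eqP.
  rewrite eq_sym subr_eq -scalerDl => /eqP e.
  have /p_inj/rowP/(_ j) : (delta_mx 0 j : 'rV_7) *m P =
     ((2 * beta (p l) (p i))^-1 * (beta (p j) (p l) + beta (p j) (p l))) *: delta_mx 0 i *m P.
    rewrite -scalemxAl -!pE -scalerA -e scalerA mulVf ?scale1r //.
    by rewrite mulf_neq0 ?pnatr_eq0 // betaC.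
  rewrite !mxE !eqxx eq_sym (negPf ij) mulr0 => /eqP; by rewrite oner_eq0.
exists ((2 * beta v (p k))^-1 *: p i), (p j), (p k), (a 0 i), (a 0 j), (a 0 k).
split; last by rewrite -scalemxAl !pg !scalerA mulrC; split.
split=> //.
  by split; rewrite ?/pos ?crossZr ?(ppos _ Ai : cross c (p i) = p i) //; apply: ppos.
by rewrite crossZl betaZl -/v invfM -mulrA mulVf // mulr1.
Qed.

End EigenFrame.

(** * Existence of a fixed axis *)

Section FixedVector.
Variable F : numClosedFieldType.
Implicit Types (x y z c u v w : 'rV[F]_7) (g h : 'M[F]_7) (t : F).

Definition gram (A B : 'M[F]_7) : 'M[F]_7 := \matrix_(i, j) beta (row i A) (row j B).

Lemma gramE A B : gram A B = A *m gram 1%:M 1%:M *m B^T.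
Proof.
apply/matrixP => i j; rewrite !mxE.
rewrite [row i A]row_sum_delta [row j B]row_sum_delta betaC beta_suml.
apply: eq_bigr => k _; rewrite !mxE betaZl betaC beta_suml mulrC; congr (_ * _).
by apply: eq_bigr => l _; rewrite !mxE betaZl !row1.
Qed.

Lemma det_gram1 : \det (gram 1%:M 1%:M) != 0.
Proof.
rewrite -unitfE -unitmxE -row_free_unit; apply: inj_row_free => v v0.
apply: beta_nondeg => y; rewrite [y]row_sum_delta betaC beta_suml big1 // => i _.
rewrite betaZl betaC [v]row_sum_delta beta_suml.
have /rowP/(_ i) := v0; rewrite !mxE => e.
rewrite (_ : \sum_(j < 7) _ = 0) ?mulr0 //; rewrite -[RHS]e.
by apply: eq_bigr => k _; rewrite betaZl !mxE !row1.
Qed.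

(** With J the Gram matrix of the form, g J g^T = J.  For e = 1 or -1 this gives
    (g - e) J g^T = - e J (g - e)^T, and taking determinants in odd dimension
    det(g - e) (det g + e) = 0.  If det(g - 1) is not 0 then det g = -1, and
    the case e = -1 yields det(g + 1) = 0. *)
Lemma sign_eigenvector g : cross_aut g ->
  exists2 e : F, e = 1 \/ e = -1 & exists2 x : 'rV[F]_7, x != 0 & x *m g = e *: x.
Proof.
move=> [gb _]; set J := gram 1%:M 1%:M.
have gJ : g *m J *m g^T = J.
  rewrite -gramE; apply/matrixP => i j; rewrite !mxE.
  by rewrite !rowE gb !mulmx1.
have ev e : \det (g - e%:M) = 0 -> exists2 x : 'rV[F]_7, x != 0 & x *m g = e *: x.
  move=> /eqP/det0P[x x0 xg]; exists x => //.
  by move/eqP: xg; rewrite mulmxBr subr_eq0 mul_mx_scalar => /eqP.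
have key (e : F) : e ^+ 2 = 1 -> \det (g - e%:M) * (\det g + e) = 0.
  move=> e2; apply: (mulfI det_gram1); rewrite mulr0 -/J.
  have : (g - e%:M) *m J *m g^T = (- e) *: (J *m (g - e%:M)^T).
    rewrite mulmxBl mulmxBl gJ mul_scalar_mx -scalemxAl.
    rewrite linearB /= tr_scalar_mx mulmxBr mul_mx_scalar scalerBr !scalerA.
    by rewrite mulNr -expr2 e2 !scaleN1r scaleNr opprK addrC.
  move/(congr1 determinant); rewrite !det_mulmx detZ det_mulmx !det_tr => d.
  have e7 : (- e) ^+ 7 = - e.
    rewrite (_ : 7%N = (2 * 3 + 1)%N) // exprD exprM sqrrN e2 expr1n mul1r.
    by rewrite expr1.
  move: (\det (g - _)) (\det J) (\det g) d => p q r; rewrite e7 => d.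
  have -> : q * (p * (r + e)) = p * q * r + e * (q * p) by ring.
  by rewrite d mulNr addNr.
have [/eqP d0|d0] := boolP (\det (g - 1%:M) == 0); first by exists 1; [left | exact: ev].
exists (-1); [by right | apply: ev].
have /eqP := key 1 (expr1n _ _); rewrite mulf_eq0 (negPf d0) /= addr_eq0 => /eqP dg.
have /eqP := key (-1) (etrans (sqrrN _) (expr1n _ _)); rewrite mulf_eq0 dg.
by rewrite -opprD oppr_eq0 -[1 + 1]/(2%:R) pnatr_eq0 orbF => /eqP.
Qed.

Lemma beta_neq0_ex x : x != 0 -> exists y, beta x y != 0.
Proof.
move=> x0; have [//|no] := pselect (exists y, beta x y != 0).
case/eqP: x0; apply: beta_nondeg => y; apply/eqP/negPn/negP => xy.
by apply: no; exists y.
Qed.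

(** Averaging y over the powers of e g projects it to the eigenspace and
    multiplies beta(x, y) by a nonzero number, so [beta] is nondegenerate on the
    eigenspace.  Hence x, y or x + y is not isotropic and can be normalized. *)
Lemma unit_eigenvector g n e x : (0 < n)%N -> g ^+ n = 1 -> cross_aut g ->
  e ^+ 2 = 1 -> x != 0 -> x *m g = e *: x ->
  exists2 c : 'rV[F]_7, c *m g = e *: c & beta c c = 1.
Proof.
move=> n_gt0 gn [gb _] e2 x0 xg.
have [y xy] := beta_neq0_ex x0.
(* The average has 2 n terms because (e g)^n is only known to be 1 or -1. *)
pose E k := e ^+ k *: (y *m g ^+ k).
pose y' := \sum_(k < n * 2) E k.
have EN : E (n * 2)%N = E 0%N.
  by rewrite /E {1}mulnC (exprM e) e2 expr1n exprM gn expr1n !expr0.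
have ES k : E k *m g = e *: E k.+1.
  by rewrite /E -scalemxAl scalerA exprS mulrA -expr2 e2 mul1r exprSr mulmxA.
have yg : y' *m g = e *: y'.
  rewrite /y' mulmx_suml; under eq_bigr do rewrite ES.
  rewrite -scaler_sumr; congr (_ *: _).
  apply: (addrI (E 0%N)); rewrite -(big_ord_recl _ (fun k : 'I__ => E k)).
  by rewrite big_ord_recr /= EN addrC.
(* beta(x, E k) does not depend on k, as e^k g^k preserves both x and the form. *)
have xgk k : x *m g ^+ k = e ^+ k *: x.
  elim: k => [|k IH]; first by rewrite !expr0 mulmx1 scale1r.
  by rewrite exprSr mulmxA IH -scalemxAl xg scalerA -exprSr.
have gbk k u v : beta (u *m g ^+ k) (v *m g ^+ k) = beta u v.
  by elim: k => [|k IH]; rewrite ?expr0 ?mulmx1 // exprSr !mulmxA gb.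
have xE k : beta x (E k) = beta x y.
  by rewrite /E betaZr -betaZl -xgk gbk.
have xy' : beta x y' != 0.
  rewrite betaC beta_suml (eq_bigr (fun=> beta x y)) => [|k _]; last by rewrite betaC.
  rewrite sumr_const card_ord -mulr_natl mulf_neq0 // pnatr_eq0.
  by rewrite muln_eq0 negb_or -!lt0n n_gt0.
have [q qg q0] : exists2 q : 'rV[F]_7, q *m g = e *: q & beta q q != 0.
  have [xx|] := eqVneq (beta x x) 0; last by exists x.
  have [yy|] := eqVneq (beta y' y') 0; last by exists y'.
  exists (x + y'); first by rewrite mulmxDl xg yg scalerDr.
  rewrite !(betaDl, betaDr) xx yy add0r addr0 (betaC y') -mulr2n -mulr_natl.
  by rewrite mulf_neq0 ?pnatr_eq0.
exists ((sqrtC (beta q q))^-1 *: q); first by rewrite -scalemxAl qg !scalerA mulrC.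
by rewrite betaZl betaZr mulrA -expr2 exprVn sqrtCK mulVf.
Qed.

(** If g reverses the axis c, it exchanges the two eigenspaces of c × _.  The
    matrix beta(ui, uj g) - beta(uj, ui g) is antisymmetric of odd size, hence
    singular; a vector x of its kernel satisfies x g = x g^-1, so x + x g is
    fixed by g. *)
Lemma fixed_vector_of_neg g c u1 u2 u3 : cross_aut g -> frame c u1 u2 u3 ->
  c *m g = - c -> exists2 x : 'rV[F]_7, x != 0 & x *m g = x.
Proof.
move=> ga fr gc; have [gb gX] := ga; have gu := cross_aut_unit gb.
pose u (i : 'I_3) := [:: u1; u2; u3]`_i.
pose v (i : 'I_3) := [:: cross u2 u3; cross u3 u1; cross u1 u2]`_i.
have up i : pos c (u i).
  by case: fr => _ [? ? ?] _; case: i => [[|[|[|//]]] ?].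
have vn i : neg c (v i).
  by case: fr => _ [? ? ?] _; case: i => [[|[|[|//]]] ?]; apply: cross_pos_neg.
have uv i j : beta (u i) (v j) = (i == j)%:R / 2.
  have f2 := frame_rot fr; have f3 := frame_rot f2.
  have [_ _ _ _ [_ _ _ _ [a1 a2 a3]]] := frame_table fr.
  have [_ _ _ _ [_ _ _ _ [b1 b2 b3]]] := frame_table f2.
  have [_ _ _ _ [_ _ _ _ [c1 c2 c3]]] := frame_table f3.
  rewrite -val_eqE.
  by case: i j => [[|[|[|//]]] ?] [[|[|[|//]]] ?]; rewrite /u /v /= ?mul0r ?mul1r.
have span z : (forall i, beta (u i) z = 0) -> neg c z -> z = 0.
  move=> uz zn; apply: beta_nondeg => y.
  have Hu := cross_aut_unit (frame_cross_aut fr).1.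
  rewrite -[y](mulmxKV Hu); move: (y *m _) => {}y; rewrite mul_frame_mx !betaDr !betaZr.
  have [e1 e2 e3] := And3 (uz 0) (uz 1) (uz 2%:R).
  rewrite /u /= in e1 e2 e3.
  have v0 i : beta z (v i) = 0 by apply: (beta_neg zn (vn i)).
  have [w1 w2 w3] := And3 (v0 0) (v0 1) (v0 2%:R).
  rewrite /v /= in w1 w2 w3.
  rewrite !(betaC z c, betaC z u1, betaC z u2, betaC z u3) (beta_axis_neg zn).
  by rewrite e1 e2 e3 w1 w2 w3 !mulr0 !addr0.
pose A : 'M[F]_3 := \matrix_(i, j) (beta (u i) (u j *m g) - beta (u j) (u i *m g)).
have detA : \det A = 0.
  apply: (@eq_opp0 F F^o); rewrite -{1}det_tr.
  have -> : A^T = (-1) *: A by apply/matrixP => i j; rewrite !mxE mulN1r opprB.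
  by rewrite detZ -signr_odd /= expr1 mulN1r.
have /eqP/det0P[k k0 kA] := detA.
pose x := \sum_i k 0 i *: u i.
have xp : pos c x.
  rewrite /pos crossC cross_suml -sumrN; apply: eq_bigr => i _.
  by rewrite crossZl -scalerN -crossC up.
have xx : x != 0.
  apply: contraNneq k0 => x0; apply/eqP/rowP => i; rewrite mxE.
  have := beta0l (v i); rewrite -x0 beta_suml (bigD1 i) //= big1 => [|j ji].
    rewrite betaZl uv eqxx mul1r addr0 => /eqP.
    by rewrite mulf_eq0 (negPf (half_neq0 _)) orbF => /eqP.
  by rewrite betaZl uv (negPf ji) mul0r mulr0.
have gVc : c *m invmx g = - c.
  by apply: (canLR (mulmxK gu)); rewrite mulNmx gc opprK.
have xgg : x *m g *m g = x.
  apply/eqP; rewrite -subr_eq0; apply/eqP.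
  have -> : x *m g *m g - x = (x *m g - x *m invmx g) *m g by rewrite mulmxBl mulmxKV.
  rewrite (span (x *m g - x *m invmx g)) ?mul0mx //.
    move=> j; rewrite betaDr betaNr -(gb (u j) (x *m invmx g)) mulmxKV //.
    have /rowP/(_ j) := kA; rewrite !mxE => e.
    apply/eqP; rewrite subr_eq0 eq_sym -subr_eq0; apply/eqP; rewrite -[RHS]e.
    rewrite (betaC (u j *m g)) (betaC (u j)) mulmx_suml !beta_suml -sumrB.
    apply: eq_bigr => i _; rewrite -scalemxAl !betaZl !mxE -mulrBr.
    by rewrite (betaC (u j)).
  have neg1 h : cross_aut h -> c *m h = - c -> cross c (x *m h) = - (x *m h).
    move=> [_ hX] hc; rewrite -[c in LHS]opprK -hc crossNl hX.
    by rewrite (xp : cross c x = x).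
  by rewrite /neg crossDr crossNr (neg1 _ ga gc) (neg1 _ (cross_autV ga) gVc) opprD.
exists (x + x *m g); last by rewrite mulmxDl xgg addrC.
apply: contra xx; rewrite addr_eq0 => /eqP xE.
have xn : cross c (x *m g) = - (x *m g).
  rewrite -[c in LHS]opprK -gc crossNl gX.
  by rewrite (xp : cross c x = x).
apply/eqP/eq_opp0; rewrite -{1}(xp : cross c x = x) {1}xE crossNr xn.
by rewrite opprK {2}xE opprK.
Qed.

(** By [sign_eigenvector] some axis is fixed or reversed, and in the second case
    [fixed_vector_of_neg] still gives a fixed vector. *)
Lemma fixed_axis g n : (0 < n)%N -> g ^+ n = 1 -> cross_aut g ->
  exists2 c : 'rV[F]_7, c *m g = c & beta c c = 1.
Proof.
move=> n_gt0 gn ga.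
suff [x x0 xg] : exists2 x : 'rV[F]_7, x != 0 & x *m g = x.
  have [||c cg c1] := @unit_eigenvector g n 1 x n_gt0 gn ga _ x0; rewrite ?expr1n ?scale1r //.
  by exists c; rewrite // cg scale1r.
have [e [] -> [x x0 xg]] := sign_eigenvector ga.
  by exists x; rewrite // xg scale1r.
have [||c cg c1] := @unit_eigenvector g n (-1) x n_gt0 gn ga _ x0; rewrite ?sqrrN ?expr1n //.
have [u1 [u2 [u3 [_ [_ [_ [fr _]]]]]]] :=
  eigenframe_exists (ltn0Sn 0) (expr1n _ 1%N) (cross_aut1 F) c1 (mulmx1 c).
by apply: fixed_vector_of_neg ga fr _; rewrite cg scaleN1r.
Qed.

Lemma weights_exist g n : (0 < n)%N -> g ^+ n = 1 -> cross_aut g ->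
  exists t1 t2 t3, weights g t1 t2 t3.
Proof.
move=> n_gt0 gn ga; have [c cg c1] := fixed_axis n_gt0 gn ga.
have [u1 [u2 [u3 [t1 [t2 [t3 [fr [e1 e2 e3]]]]]]]] := eigenframe_exists n_gt0 gn ga c1 cg.
by exists t1, t2, t3, c, u1, u2, u3.
Qed.

End FixedVector.

(** * Conjugacy classes of torsion elements and points of the alcove *)

Section Classes.
Variable F : numClosedFieldType.
Implicit Types (x y g h : 'M[F]_7) (t : F).

(** u1 is nonzero because beta(u1 × u2, u3) is. *)
Lemma weights_torsion g n t1 t2 t3 : g ^+ n = 1 -> weights g t1 t2 t3 -> t1 ^+ n = 1.
Proof.
move=> gn [c [u1 [u2 [u3 [[_ _ e] [_ g1 _ _]]]]]].
have u1n k : u1 *m g ^+ k = t1 ^+ k *: u1.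
  elim: k => [|k IH]; first by rewrite !expr0 mulmx1 scale1r.
  by rewrite exprSr mulmxA IH -scalemxAl g1 scalerA -exprSr.
have /eqP := u1n n; rewrite gn mulmx1 -subr_eq0 -{1}[u1]scale1r -scalerBl scaler_eq0.
case/orP; first by rewrite subr_eq0 => /eqP.
move=> /eqP u0; move: e; rewrite u0 cross0l beta0l => /esym/eqP.
by rewrite (negPf (half_neq0 F)).
Qed.

(** A fundamental domain for the affine Weyl group on the exponents
    (a, b, -(a + b)) modulo m: a and b - a are the values of the simple roots and
    a + 2 b = 3 a + 2 (b - a) is that of the highest root. *)
Definition alcove (m : nat) (p : nat * nat) := (p.1 <= p.2)%N && (p.1 + 2 * p.2 <= m)%N.

Lemma alcove_le m p : alcove m p -> (p.1 + p.2 <= m)%N.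
Proof. by case: p => a b /andP[/= ? ?]; lia. Qed.

Section Root.
Variables (m : nat) (z : F).
Hypothesis zP : m.-primitive_root z.

Let m_gt0 : (0 < m)%N. Proof. exact: prim_order_gt0 zP. Qed.

Let zE i j : (i = j %[mod m])%N -> z ^+ i = z ^+ j.
Proof. by move=> e; apply/eqP; rewrite (eq_prim_root_expr zP) e. Qed.

Let z_neq0 : z != 0.
Proof.
apply: contra_eq_neq (prim_expr_order zP) => ->.
by rewrite expr0n gtn_eqF // eq_sym oner_neq0.
Qed.

Let zV e : (e <= m)%N -> (z ^+ e)^-1 = z ^+ (m - e).
Proof.
move=> em; have ze : z ^+ e != 0 by rewrite expf_neq0.
by apply: (mulIf ze); rewrite -exprD subnK // (prim_expr_order zP) mulVf.
Qed.

(** If the distances d1 <= d2 <= d3 of the exponents to 0 modulo m are sorted,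
    then (d1, d2) is the point of the alcove.  A global inversion makes the first
    exponent equal to d1.  If the second one is then -d2, the third distance is
    d2 - d1, and d2 <= d2 - d1 forces d1 = 0, so that a global inversion corrects
    the sign. *)
Lemma weights_alcove_sorted g e1 e2 e3 : cross_aut g ->
  (e1 <= m)%N -> (e2 <= m)%N -> (e3 <= m)%N ->
  weights g (z ^+ e1) (z ^+ e2) (z ^+ e3) ->
  (minn e1 (m - e1) <= minn e2 (m - e2) <= minn e3 (m - e3))%N ->
  exists2 p, alcove m p & weights g (z ^+ p.1) (z ^+ p.2) (z ^+ (m - (p.1 + p.2))).
Proof.
move=> ga; wlog e1m : e1 e2 e3 / (2 * e1 <= m)%N.
  move=> W h1 h2 h3 gw; have [|e1m] := leqP (2 * e1) m.
    by move=> ? ?; apply: (W e1 e2 e3).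
  move=> s; apply: (W (m - e1) (m - e2) (m - e3))%N; rewrite ?leq_subr //.
  - by lia.
  - by rewrite -!zV //; apply: weights_inv.
  - by rewrite !subKn // ![minn (m - _)%N _]minnC.
move=> h1 h2 h3 gw /andP[s12 s23].
have : (m %| e1 + e2 + e3)%N.
  have := weights_prod ga gw; rewrite -!exprD => /eqP.
  by rewrite -(prim_order_dvd zP).
case/dvdnP => q qE.
have q_le : (q <= 3)%N by rewrite -(leq_pmul2r m_gt0) -qE; lia.
have [e2m|e2m] := leqP (2 * e2) m.
  exists (e1, e2) => /=.
    by rewrite /alcove /=; move: q q_le qE => [|[|[|[|//]]]] _ qE; lia.
  rewrite -(@zE e3 (m - (e1 + e2))%N) // -(modnDr e3).
  by rewrite (_ : e3 + m = q * m + (m - (e1 + e2)))%N ?modnMDl //; lia.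
have e10 : e1 = 0%N by move: q q_le qE => [|[|[|[|//]]]] _ qE; lia.
exists (0%N, m - e2)%N; first by rewrite /alcove /=; lia.
have := weights_inv ga gw; rewrite !zV // e10 subn0 (prim_expr_order zP) add0n.
rewrite (@zE (m - e3) (m - (m - e2))) //= -(modnMDl q (m - e3)).
rewrite -(modnMDl 1 (m - (m - e2))).
by congr (_ %% _)%N; lia.
Qed.

(** Permutations of the eigenvalues sort the distances to 0. *)
Lemma weights_alcove g : cross_aut g -> g ^+ m = 1 ->
  exists2 p, alcove m p & weights g (z ^+ p.1) (z ^+ p.2) (z ^+ (m - (p.1 + p.2))).
Proof.
move=> ga gm; have [t1 [t2 [t3 w]]] := weights_exist m_gt0 gm ga.
have t1m := weights_torsion gm w.
have t2m := weights_torsion gm (weights_rot w).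
have t3m := weights_torsion gm (weights_rot (weights_rot w)).
have [e1 E1] := prim_rootP zP t1m.
have [e2 E2] := prim_rootP zP t2m.
have [e3 E3] := prim_rootP zP t3m.
rewrite E1 E2 E3 in w; clear t1m t2m t3m E1 E2 E3 t1 t2 t3.
have [l1 l2 l3] : [/\ e1 <= m, e2 <= m & e3 <= m]%N by split; apply: ltnW.
pose d (e : 'I_m) := minn e (m - e).
have w1 := weights_rot w; have w2 := weights_rot w1.
have W := weights_alcove_sorted ga.
have [le12|/ltnW le21] := leqP (d e1) (d e2);
have [le23|/ltnW le32] := leqP (d e2) (d e3);
have [le13|/ltnW le31] := leqP (d e1) (d e3).
- by apply: (W e1 e2 e3) => //; apply/andP.
- by apply: (W e1 e2 e3) => //; apply/andP.
- by apply: (W e1 e3 e2) => //; [exact: weights_rot (weights_swap w) | apply/andP].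
- by apply: (W e3 e1 e2) => //; apply/andP.
- by apply: (W e2 e1 e3) => //; [exact: weights_swap w | apply/andP].
- by apply: (W e2 e3 e1) => //; apply/andP.
- by apply: (W e3 e2 e1) => //; [exact: weights_swap w1 | apply/andP].
- by apply: (W e3 e2 e1) => //; [exact: weights_swap w1 | apply/andP].
Qed.

(** Exponents of the seven diagonal entries, written without negative numbers
    and in the order of [torus]. *)
Definition weight_exps (p : nat * nat) : seq nat :=
  [:: 0; p.1; p.2; m - (p.1 + p.2); m - p.1; m - p.2; p.1 + p.2]%N.

Definition alcove_elt p : 'M[F]_7 := torus (z ^+ p.1) (z ^+ p.2) (z ^+ (m - (p.1 + p.2))).

Lemma alcove_elt_prod p : alcove m p ->
  z ^+ p.1 * z ^+ p.2 * z ^+ (m - (p.1 + p.2)) = 1.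
Proof.
by move=> /alcove_le p_le; rewrite -!exprD subnKC ?(prim_expr_order zP).
Qed.

Lemma alcove_eltE p : alcove m p ->
  alcove_elt p = diag_mx (vec7 [seq z ^+ e | e <- weight_exps p]).
Proof.
case: p => a b /alcove_le /= ab; rewrite /alcove_elt /torus /weight_exps /= -!exprD expr0.
by do 2?[congr diag_mx; congr vec7]; do ?congr (_ :: _); congr (_ ^+ _); lia.
Qed.

Lemma alcove_elt_aut p : alcove m p -> cross_aut (alcove_elt p).
Proof. by move=> /alcove_elt_prod; exact: torus_aut. Qed.

Lemma alcove_elt_torsion p : alcove m p -> alcove_elt p ^+ m = 1.
Proof.
move=> pa; rewrite alcove_eltE //; set d := vec7 _.
have dn n : diag_mx d ^+ n = diag_mx (\row_i (d 0 i ^+ n)).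
  elim: n => [|n IH].
    rewrite expr0 -[1]/(1%:M) -diag_const_mx; congr diag_mx.
    by apply/rowP => i; rewrite !mxE expr0.
  rewrite exprSr IH -[_ * _]/(_ *m _) mulmx_diag; congr diag_mx.
  by apply/rowP => i; rewrite !mxE exprSr.
rewrite dn -[1]/(1%:M) -diag_const_mx; congr diag_mx; apply/rowP => i.
rewrite !mxE (nth_map 0%N) ?size_map //.
by rewrite -exprM mulnC exprM (prim_expr_order zP) expr1n.
Qed.

End Root.

Lemma char_poly_diag (s : seq F) : size s = 7%N ->
  char_poly (diag_mx (vec7 s)) = \prod_(x <- s) ('X - x%:P).
Proof.
move=> s7; rewrite char_poly_trig; last exact/diag_mx_is_trig.
rewrite [RHS](big_nth 0) s7 big_mkord; apply: eq_bigr => i _.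
by rewrite !mxE eqxx mulr1n.
Qed.

Lemma conj_class_conj x h : cross_aut h ->
  conj_class (G2 F) (h *m x *m invmx h) = conj_class (G2 F) x.
Proof.
move=> ha; have hu := cross_aut_unit ha.1.
apply/seteqP; split=> y [k /G2E ka <-]; have ku := cross_aut_unit ka.1.
  exists (k *m h); first by apply/G2E/cross_autM.
  by rewrite invmx_mul // !mulmxA.
exists (k *m invmx h); first by apply/G2E/cross_autM/cross_autV.
by rewrite invmx_mul ?unitmx_inv // invmxK !mulmxA !mulmxKV.
Qed.

Lemma mem_conj_class x : conj_class (G2 F) x x.
Proof.
exists 1%:M; first by apply/G2E/cross_aut1.
by rewrite mul1mx invmx1 mulmx1.
Qed.

Lemma char_poly_conj_class x y : conj_class (G2 F) x y -> char_poly y = char_poly x.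
Proof. by move=> [h /G2E ha <-]; rewrite char_poly_conj // (cross_aut_unit ha.1). Qed.

Section Alcove.
Variables (m : nat) (z : F).
Hypothesis zP : m.-primitive_root z.

Let m_gt0 : (0 < m)%N. Proof. exact: prim_order_gt0 zP. Qed.

Lemma char_poly_alcove_elt p : alcove m p ->
  char_poly (alcove_elt m z p) = \prod_(x <- [seq z ^+ e | e <- weight_exps m p]) ('X - x%:P).
Proof. by move=> pa; rewrite alcove_eltE // char_poly_diag. Qed.

(** The distance to 0 modulo m of the exponent of a power of z. *)
Definition fold_log (x : F) : nat :=
  let e := index x [seq z ^+ i | i <- iota 0 m] in minn e (m - e).

Lemma fold_logE e : fold_log (z ^+ e) = minn (e %% m) (m - e %% m).
Proof.
rewrite /fold_log; set s := map _ _.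
suff -> : index (z ^+ e) s = (e %% m)%N by [].
have em : (e %% m < m)%N by rewrite ltn_mod.
have -> : z ^+ e = nth 0 s (e %% m)%N.
  by rewrite (nth_map 0%N) ?size_iota // nth_iota // add0n (prim_expr_mod zP).
apply: index_uniq; first by rewrite size_map size_iota.
rewrite map_inj_in_uniq ?iota_uniq // => i j; rewrite !mem_iota /= => i_n j_n.
by move/eqP; rewrite (eq_prim_root_expr zP) !modn_small // => /eqP.
Qed.

(** On the alcove the distances of ±a, ±b, ±(a + b) to 0 are a <= b <= c, so that
    sorting the distances of all the exponents recovers a and b. *)
Lemma alcove_fold p : alcove m p ->
  let c := minn (p.1 + p.2) (m - (p.1 + p.2)) in
  sorted leq [:: 0; p.1; p.1; p.2; p.2; c; c]%N /\
  perm_eq [seq fold_log (z ^+ e) | e <- weight_exps m p] [:: 0; p.1; p.1; p.2; p.2; c; c]%N.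
Proof.
case: p => a b /andP[/= ab abm] /=.
have dE e : (e <= m)%N -> fold_log (z ^+ e) = minn e (m - e).
  rewrite leq_eqVlt => /orP[/eqP ->|em]; first by rewrite fold_logE modnn subnn min0n minn0.
  by rewrite fold_logE modn_small.
split; first by rewrite ab !leqnn /= !andbT; lia.
rewrite !dE; try lia.
have -> : minn 0 (m - 0) = 0%N by lia.
have -> : minn a (m - a) = a by lia.
have -> : minn b (m - b) = b by lia.
have -> : minn (m - a) (m - (m - a)) = a by lia.
have -> : minn (m - b) (m - (m - b)) = b by lia.
have -> : minn (m - (a + b)) (m - (m - (a + b))) = minn (a + b) (m - (a + b)) by lia.
by apply/permP => P /=; lia.
Qed.

(** Conjugate matrices have the same characteristic polynomial, hence the same
    multiset of eigenvalues, hence the same sorted list of distances. *)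
Lemma alcove_elt_inj p q : alcove m p -> alcove m q ->
  conj_class (G2 F) (alcove_elt m z p) = conj_class (G2 F) (alcove_elt m z q) -> p = q.
Proof.
move=> pa qa e; have := mem_conj_class (alcove_elt m z p); rewrite e.
move/char_poly_conj_class; rewrite !char_poly_alcove_elt //.
move/prod_XsubC_eq/(perm_map fold_log); rewrite -!map_comp.
have [ps pp] := alcove_fold pa; have [qs qq] := alcove_fold qa.
move=> pq; have := sorted_eq leq_trans anti_leq ps qs.
have lpq := perm_trans (perm_trans (_ : perm_eq _ _) pq) qq.
rewrite {}lpq; last by rewrite perm_sym.
by case: p q {pa qa e ps pp qs qq pq} => a b [c d] /= /(_ isT) [-> _ ->].
Qed.

(** Powers of z agree exactly when their exponents agree modulo m. *)
Lemma card_eigen p y : alcove m p -> conj_class (G2 F) (alcove_elt m z p) y ->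
  ([set a | eigenvalue y a] #=
   `I_(size (undup [seq (e %% m)%N | e <- weight_exps m p])))%card.
Proof.
move=> pa /char_poly_conj_class ye.
have -> : [set a | eigenvalue y a] = [set` undup [seq z ^+ e | e <- weight_exps m p]].
  apply/seteqP; split=> a; rewrite /mkset mem_undup eigenvalue_root_char ye.
    by rewrite char_poly_alcove_elt // root_prod_XsubC.
  by rewrite char_poly_alcove_elt // root_prod_XsubC.
have -> : [seq z ^+ e | e <- weight_exps m p] =
    [seq z ^+ e | e <- [seq (e %% m)%N | e <- weight_exps m p]].
  by rewrite -map_comp; apply: eq_map => e /=; rewrite (prim_expr_mod zP).
rewrite -(@size_undup_map_in _ _ (fun e => z ^+ e)); first exact/card_eq_uniq/undup_uniq.
move=> i j /mapP[i' _ ->] /mapP[j' _ ->] /eqP.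
by rewrite (eq_prim_root_expr zP) !modn_mod => /eqP.
Qed.

Definition alcove_set s : {set 'I_m.+1 * 'I_m.+1} :=
  [set p | alcove m (val p.1, val p.2) &&
     (size (undup [seq (e %% m)%N | e <- weight_exps m (val p.1, val p.2)]) == s)]%SET.

Lemma torsion_eigen_classesE s : torsion_eigen_classes (G2 F) m s =
  [set conj_class (G2 F) (alcove_elt m z (val p.1, val p.2)) | p in [set` alcove_set s]].
Proof.
apply/seteqP; split=> K.
- move=> [[x /G2E xa ->] Ks].
  have [_ xm xs] := Ks _ (mem_conj_class x).
  have [[a b] pa w] := weights_alcove zP xa xm.
  have [h ha hx] := weights_conj xa w.
  have xE : conj_class (G2 F) x = conj_class (G2 F) (alcove_elt m z (a, b)).
    by rewrite -(conj_class_conj x ha) hx.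
  have am : (a < m.+1)%N by have := alcove_le pa => /=; lia.
  have bm : (b < m.+1)%N by have := alcove_le pa => /=; lia.
  exists (Ordinal am, Ordinal bm) => //=; rewrite inE pa /=.
  have := mem_conj_class x; rewrite xE => /(card_eigen pa) xs'.
  have : (`I_s #= `I_(size (undup [seq (e %% m)%N | e <- weight_exps m (a, b)])))%card.
    by apply: card_eq_trans xs'; rewrite card_eq_sym.
  by move/card_eq_II => <-.
- move=> [[a b]] /=; rewrite inE /= => /andP[pa /eqP ps] <-; split.
    by exists (alcove_elt m z (val a, val b)) => //; apply/G2E/alcove_elt_aut.
  move=> y yc; have ye := card_eigen pa yc; rewrite ps in ye; split=> //.
    case: yc => h /G2E ha <-; apply/G2E.
    by apply: cross_autM (cross_autV ha); apply: cross_autM (alcove_elt_aut zP pa).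
  case: yc => h /G2E ha <-; have hu := cross_aut_unit ha.1.
  have hX n : (h *m alcove_elt m z (val a, val b) *m invmx h) ^+ n =
      h *m (alcove_elt m z (val a, val b) ^+ n) *m invmx h.
    elim: n => [|n IH]; first by rewrite !expr0 mulmx1 mulmxV.
    by rewrite exprSr IH exprSr -[LHS]/(_ *m _) !mulmxA mulmxKV.
  by rewrite hX alcove_elt_torsion // mulmx1 mulmxV.
Qed.

Lemma nclassesE s :
  finite_set (torsion_eigen_classes (G2 F) m s) /\
  nclasses (G2 F) m s = #|alcove_set s|.
Proof.
have e : (torsion_eigen_classes (G2 F) m s #= `I_(#|alcove_set s|))%card.
  rewrite torsion_eigen_classesE.
  apply: card_eq_trans (inj_card_eq _) _.
    move=> [a b] [c d]; rewrite !inE /= !inE /= => /andP[pa _] /andP[qa _].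
    by move=> /(alcove_elt_inj pa qa) [/val_inj -> /val_inj ->].
  rewrite cardE; have := card_eq_uniq (enum_uniq (mem (alcove_set s))).
  by congr (_ #= _)%card; apply/seteqP; split=> p /=; rewrite mem_enum.
split; last exact: card_fset_set.
by apply/finite_setP; eexists; exact: e.
Qed.

End Alcove.
End Classes.

(** * Counting points of the alcove *)

Section Counting.
Local Open Scope nat_scope.
Variable m : nat.
Hypothesis m_gt0 : (0 < m)%N.

Definition num_eigen a b := size (undup [seq (e %% m)%N | e <- weight_exps m (a, b)]).

Definition eigen_ind s a b : nat := alcove m (a, b) && (num_eigen a b == s).

(** Two of the exponents agree modulo m only on the walls a = 0, a = b and
    a + 2 b = m of the alcove and on the line 2 (a + b) = m, where a + b is its
    own opposite.  The points singled out on the walls are the intersections of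
    these lines. *)
Lemma num_eigenE a b : alcove m (a, b) -> num_eigen a b =
  if b == 0%N then 1%N
  else if a == 0%N then (if (2 * b == m)%N then 2 else 3)%N
  else if a == b then
    (if (3 * a == m)%N then 3 else if (4 * a == m)%N then 4 else 5)%N
  else if (a + 2 * b == m)%N then 5%N
  else if (2 * (a + b) == m)%N then 6%N else 7%N.
Proof.
move=> /andP[/= ab abm]; rewrite /num_eigen /weight_exps /=.
have mm e : (e < m)%N -> (e %% m = e)%N by exact: modn_small.
have [b0|b0] := eqVneq b 0%N.
  by rewrite (_ : a = 0)%N ?b0 ?subn0 ?mod0n ?modnn //; lia.
have [a0|a0] := eqVneq a 0%N.
  rewrite a0 add0n subn0 mod0n modnn !mm; try lia.
  rewrite !inE.
  have -> : (0%N == b) = false by lia.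
  have -> : (0%N == m - b) = false by lia.
  have -> : (b == m - b) = (2 * b == m) by lia.
  have -> : (m - b == b) = (2 * b == m) by lia.
  by rewrite !eqxx /= !orbT; case: eqP.
rewrite !mm; try lia; rewrite ?mod0n !inE.
have -> : (0%N == a) = false by lia.
have -> : (0%N == b) = false by lia.
have -> : (0%N == m - (a + b)) = false by lia.
have -> : (0%N == m - a) = false by lia.
have -> : (0%N == m - b) = false by lia.
have -> : (0%N == a + b) = false by lia.
have -> : (a == m - (a + b)) = (2 * a + b == m)%N by lia.
have -> : (a == m - a) = false by lia.
have -> : (a == m - b) = false by lia.
have -> : (a == a + b) = false by lia.
have -> : (b == m - (a + b)) = (a + 2 * b == m)%N by lia.
have -> : (b == m - a) = false by lia.
have -> : (b == m - b) = false by lia.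
have -> : (b == a + b) = false by lia.
have -> : (m - (a + b) == m - a)%N = false by lia.
have -> : (m - (a + b) == m - b)%N = false by lia.
have -> : (m - (a + b) == a + b)%N = (2 * (a + b) == m)%N by lia.
have -> : (m - a == m - b)%N = (a == b) by lia.
have -> : (m - a == a + b)%N = (2 * a + b == m)%N by lia.
have -> : (m - b == a + b)%N = (a + 2 * b == m)%N by lia.
case: (a =P b) => [<-|ab'].
  have -> : (2 * a + a = 3 * a)%N by lia.
  have -> : (a + 2 * a = 3 * a)%N by lia.
  have -> : (2 * (a + a) = 4 * a)%N by lia.
  by case: (3 * a =P m) => ?; case: (4 * a =P m) => ?; rewrite //=; lia.
have -> : (2 * a + b == m)%N = false by lia.
by case: (a + 2 * b =P m) => ?; case: (2 * (a + b) =P m) => ?; rewrite //=; lia.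
Qed.

Lemma card_alcove_set s :
  #|alcove_set m s| = (\sum_(0 <= a < m.+1) \sum_(0 <= b < m.+1) eigen_ind s a b)%N.
Proof.
rewrite -sum1_card big_mkcond big_mkord.
under [RHS]eq_bigr do rewrite big_mkord.
rewrite pair_bigA /=; apply: eq_bigr => -[a b] _ /=.
by rewrite inE /eigen_ind /num_eigen; case: (_ && _).
Qed.

(** [sum_point], [sum_graph] and [sum_cograph] evaluate sums over pairs whose
    terms vanish off a graph, i.e. they count the points on a line. *)
Lemma sum_point N (Q : bool) c : (Q -> c < N)%N ->
  (\sum_(0 <= b < N) (Q && (b == c)))%N = Q.
Proof.
case: Q => [/(_ isT) cN|_]; last by rewrite big1.
rewrite big_mkord (bigD1 (Ordinal cN)) //= eqxx big1 // => i.
by rewrite -val_eqE /= => /negPf ->.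
Qed.

(** The number of values of one coordinate along a wall or, when the other
    coordinate is fixed, inside the alcove. *)
Lemma sum_multiples lo k M N : 0 < k -> M %/ k < N ->
  \sum_(0 <= a < N) ((lo < a) && (k * a <= M)) = M %/ k - lo.
Proof.
move=> k_gt0; case: N => // N MN.
suff -> : \sum_(0 <= a < N.+1) ((lo < a) && (k * a <= M)) = minn (M %/ k) N - lo.
  by congr (_ - _); lia.
elim: N {MN} => [|N IH]; first by rewrite big_nat1 minn0.
by rewrite big_nat_recr //= IH mulnC -leq_divRL //; lia.
Qed.

Lemma sum_graph (Q : pred nat) (f : nat -> nat) : (forall a, Q a -> f a <= m) ->
  \sum_(0 <= a < m.+1) \sum_(0 <= b < m.+1) (Q a && (b == f a)) =
  \sum_(0 <= a < m.+1) Q a.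
Proof. by move=> Qf; apply: eq_bigr => a _; apply: sum_point => /Qf. Qed.

Lemma sum_cograph (Q : pred nat) (f : nat -> nat) : (forall b, Q b -> f b <= m) ->
  \sum_(0 <= a < m.+1) \sum_(0 <= b < m.+1) (Q b && (a == f b)) =
  \sum_(0 <= b < m.+1) Q b.
Proof. by rewrite exchange_big; apply: sum_graph. Qed.

Lemma eq_sum2 (E G : nat -> nat -> nat) : (forall a b, E a b = G a b) ->
  \sum_(0 <= a < m.+1) \sum_(0 <= b < m.+1) E a b =
  \sum_(0 <= a < m.+1) \sum_(0 <= b < m.+1) G a b.
Proof. by move=> EG; apply: eq_bigr => a _; apply: eq_bigr. Qed.

Lemma sum2D (E G : nat -> nat -> nat) :
  \sum_(0 <= a < m.+1) \sum_(0 <= b < m.+1) (E a b + G a b) =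
  \sum_(0 <= a < m.+1) \sum_(0 <= b < m.+1) E a b +
  \sum_(0 <= a < m.+1) \sum_(0 <= b < m.+1) G a b.
Proof. by rewrite -big_split; apply: eq_bigr => a _; rewrite big_split. Qed.

Ltac by_num_eigen := let pa := fresh in
  rewrite /eigen_ind; have [pa|pa] := boolP (alcove _ _);
  [rewrite num_eigenE //; move: pa; rewrite /alcove /=; do ![case: eqP => //=]; lia
  |move: pa; rewrite /alcove /=; lia].

Lemma card_alcove1 : #|alcove_set m 1| = 1.
Proof.
rewrite card_alcove_set (@eq_sum2 _ (fun a b => (a == 0) && (b == 0))).
  by rewrite sum_graph // -[RHS](@sum_point m.+1 true 0).
by move=> a b; by_num_eigen.
Qed.

Lemma card_alcove2 : #|alcove_set m 2| + m.-1 %/ 2 = m %/ 2.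
Proof.
rewrite card_alcove_set
  (@eq_sum2 _ (fun a b => ((a == 0) && (m %% 2 == 0)) && (b == m %/ 2))).
  rewrite sum_graph; last by move=> a _; lia.
  by under eq_bigr do rewrite andbC; rewrite sum_point //; lia.
by move=> a b; by_num_eigen.
Qed.

Lemma card_alcove3 : #|alcove_set m 3| + m.-1 %/ 3 = m.-1 %/ 2 + m %/ 3.
Proof.
rewrite card_alcove_set
  (@eq_sum2 _ (fun a b => (((0 < b) && (2 * b <= m.-1)) && (a == 0)) +
                          ((m %% 3 == 0) && (a == m %/ 3)) && (b == a))).
  rewrite sum2D sum_cograph // sum_multiples //; last by lia.
  rewrite (@sum_graph (fun a => (m %% 3 == 0) && (a == m %/ 3)) id); last by move=> a; lia.
  by rewrite sum_point //; lia.
by move=> a b; by_num_eigen.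
Qed.

Lemma card_alcove4 : #|alcove_set m 4| + m.-1 %/ 4 = m %/ 4.
Proof.
rewrite card_alcove_set
  (@eq_sum2 _ (fun a b => ((m %% 4 == 0) && (a == m %/ 4)) && (b == a))).
  rewrite (@sum_graph (fun a => (m %% 4 == 0) && (a == m %/ 4)) id); last by move=> a; lia.
  by rewrite sum_point //; lia.
by move=> a b; by_num_eigen.
Qed.

(** The points are those on the wall a = b other than its special points, and
    those inside the wall a + 2 b = m, where m/3 < b < m/2. *)
Lemma card_alcove5 : #|alcove_set m 5| + m %/ 3 + m %/ 4 =
  m.-1 %/ 2 + m.-1 %/ 3 + m.-1 %/ 4.
Proof.
have e4 := card_alcove4; rewrite -addnA (addnC (m %/ 3)) addnA -e4 addnA.
rewrite !card_alcove_set -sum2D.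
rewrite (@eq_sum2 _ (fun a b => (((0 < a) && (3 * a <= m.-1)) && (b == a)) +
                          ((2 * b < m) && (m < 3 * b)) && (a == m - 2 * b))).
  rewrite sum2D (@sum_graph _ id); last by move=> a; lia.
  rewrite sum_multiples //; last by lia.
  rewrite sum_cograph; last by move=> b; lia.
  rewrite (@eq_bigr _ _ _ _ _ _ _ (fun b => (m %/ 3 < b) && (2 * b <= m.-1) : nat)) => [|b _].
    by rewrite sum_multiples //; lia.
  by congr nat_of_bool; lia.
by move=> a b; by_num_eigen.
Qed.

(** On the line 2 (a + b) = m the point is determined by a with 0 < a < m/4. *)
Lemma card_alcove6 : #|alcove_set m 6| = (m %% 2 == 0) * (m.-1 %/ 4).
Proof.
rewrite card_alcove_set
  (@eq_sum2 _ (fun a b => ((m %% 2 == 0) && ((0 < a) && (4 * a <= m.-1))) && (b == m %/ 2 - a))).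
  rewrite sum_graph; last by move=> a _; lia.
  case: (m %% 2 == 0); last by rewrite big1.
  by rewrite mul1n sum_multiples //; lia.
by move=> a b; by_num_eigen.
Qed.

(** The number of lattice points with 0 < a < b and a + 2 b < n, the term of index
    a counting the possible b for the first coordinate a + 1. *)
Definition interior_count n := \sum_(0 <= a < n) (((n - a.+2) %/ 2) - a.+1).

Lemma card_alcove7 : #|alcove_set m 7| + #|alcove_set m 6| = interior_count m.
Proof.
rewrite !card_alcove_set -sum2D.
rewrite (@eq_sum2 _ (fun a b => (0 < a) && ((a < b) && (2 * b <= m - a.+1)))); last first.
  by move=> a b; by_num_eigen.
rewrite big_nat_recl //= big1 ?add0n => [|b _ //].
apply: eq_big_nat => a /andP[_ am].
by rewrite sum_multiples //; lia.
Qed.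

End Counting.

(** Translation by (2, 2) maps the points for n onto those for n + 6 with first
    coordinate at least 3; the points with first coordinate 1 or 2 number n. *)
Lemma interior_count_add6 n : (0 < n)%N -> interior_count (n + 6) = (interior_count n + n)%N.
Proof.
move=> n_gt0; rewrite /interior_count (_ : n + 6 = n.+4.+2)%N; last by lia.
rewrite 2?big_nat_recl //.
rewrite (@eq_bigr _ _ _ _ _ _ _ (fun a => (n - a.+2) %/ 2 - a.+1)%N) => [|a _]; last by lia.
rewrite !big_nat_recr //=; lia.
Qed.

Lemma interior_count_add12 k r : (0 < r)%N ->
  (interior_count (12 * k + r) + 6 * k = interior_count r + 12 * (k * k) + 2 * (r * k))%N.
Proof.
move=> r_gt0; elim: k => [|k IH]; first by rewrite !muln0 !addn0.
rewrite (_ : 12 * k.+1 + r = (12 * k + r) + 6 + 6)%N; last by lia.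
by rewrite !interior_count_add6; lia.
Qed.

Lemma interior_count_small : [/\ forall r, (r <= 5)%N -> interior_count r = 0%N,
  interior_count 6 = 1%N, interior_count 7 = 1%N & interior_count 8 = 2%N] /\
  [/\ interior_count 9 = 3%N, interior_count 10 = 4%N, interior_count 11 = 5%N
    & interior_count 12 = 7%N].
Proof.
split; split; try by rewrite /interior_count unlock.
by move=> [|[|[|[|[|[|//]]]]]]; rewrite /interior_count unlock.
Qed.

Theorem theorem4p19 (R : realType) (m s : nat) :
  (0 < m)%N -> (1 <= s <= 7)%N ->
  let q : rat := m%:R in
  let N : rat := (nclasses (G2 R[i]) m s)%:R in
  finite_set (torsion_eigen_classes (G2 R[i]) m s) /\
  ((m %% 12 = 0)%N ->
     N = [:: 1; 1; q / 2; 1; (q - 6) / 2; (q - 4) / 4;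
             q * (q - 9) / 12 + 2]`_s.-1) /\
  ((m %% 12)%N \in [:: 1; 5; 7; 11]%N ->
     N = [:: 1; 0; (q - 1) / 2; 0; (q - 1) / 2; 0;
             (q - 1) * (q - 5) / 12]`_s.-1) /\
  ((m %% 12)%N \in [:: 2; 10]%N ->
     N = [:: 1; 1; (q - 2) / 2; 0; (q - 2) / 2; (q - 2) / 4;
             (q - 2) * (q - 7) / 12]`_s.-1) /\
  ((m %% 12)%N \in [:: 3; 9]%N ->
     N = [:: 1; 0; (q + 1) / 2; 0; (q - 3) / 2; 0;
             (q - 3) ^+ 2 / 12]`_s.-1) /\
  ((m %% 12)%N \in [:: 4; 8]%N ->
     N = [:: 1; 1; (q - 2) / 2; 1; (q - 4) / 2; (q - 4) / 4;
             (q - 4) * (q - 5) / 12]`_s.-1) /\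
  ((m %% 12 = 6)%N ->
     N = [:: 1; 1; q / 2; 0; (q - 4) / 2; (q - 2) / 4;
             (q - 3) * (q - 6) / 12]`_s.-1).
Proof.
move=> m_gt0 s17 q N.
have [z zP] := prim_root_exists R[i] m_gt0.
have [fin cardE] := nclassesE zP s; split=> //.
pose A (n : nat) : nat := #|alcove_set m n|.
have NE : N = (A s)%:R by rewrite /N cardE.
have c1 : A 1%N = 1%N := card_alcove1 m_gt0.
have c2 : (A 2 + m.-1 %/ 2 = m %/ 2)%N := card_alcove2 m_gt0.
have c3 : (A 3 + m.-1 %/ 3 = m.-1 %/ 2 + m %/ 3)%N := card_alcove3 m_gt0.
have c4 : (A 4 + m.-1 %/ 4 = m %/ 4)%N := card_alcove4 m_gt0.
have c5 : (A 5 + m %/ 3 + m %/ 4 = m.-1 %/ 2 + m.-1 %/ 3 + m.-1 %/ 4)%N := card_alcove5 m_gt0.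
have c6 : (A 6 = (m %% 2 == 0) * (m.-1 %/ 4))%N := card_alcove6 m_gt0.
have c7 : (A 7 + A 6 = interior_count m)%N := card_alcove7 m_gt0.
rewrite {N fin cardE}NE; clearbody A.
have [[t5 t6 t7 t8] [t9 t10 t11 t12]] := interior_count_small.
have lin n b c d : (0 < d)%N -> (d * n + c = m + b)%N ->
    n%:R = (q + b%:R - c%:R) / d%:R :> rat.
  move=> d_gt0 e; apply: (canRL (mulfK _)); first by rewrite pnatr_eq0 -lt0n.
  by rewrite -natrD -e natrD natrM addrK mulrC.
(* Residue 0 is represented by r = 12: the recursion needs a positive argument. *)
have tri r : (0 < r <= 12)%N -> (m %% 12 = r %% 12)%N -> exists k,
    q = 12 * k%:R + r%:R /\
    (A 7%N)%:R + (A 6%N)%:R + 6 * k%:R =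
      (interior_count r)%:R + 12 * (k%:R * k%:R) + 2 * (r%:R * k%:R) :> rat.
  move=> r12 e; have [k mE] : exists k, m = (12 * k + r)%N.
    by exists ((m - r) %/ 12)%N; lia.
  exists k; rewrite {1}/q mE natrD natrM; split=> //.
  rewrite -!natrM -!natrD; congr (_%:R).
  by rewrite c7 mE interior_count_add12 //; lia.
move: s17; case: s => [//|[|[|[|[|[|[|[|//]]]]]]]] _ /=.
- by rewrite c1.
- have e h : A 2%N = h -> (A 2%N)%:R = h%:R :> rat by move=> ->.
  do !split; rewrite ?inE => h;
    [apply: (e 1%N)|apply: (e 0%N)|apply: (e 1%N)|
     apply: (e 0%N)|apply: (e 1%N)|apply: (e 1%N)]; lia.
- split=> [h|]; first by rewrite (@lin _ 0 0 2)%N //; [lra | lia].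
  split=> [h|]; first by rewrite !inE in h; rewrite (@lin _ 0 1 2)%N //; [lra | lia].
  split=> [h|]; first by rewrite !inE in h; rewrite (@lin _ 0 2 2)%N //; [lra | lia].
  split=> [h|]; first by rewrite !inE in h; rewrite (@lin _ 1 0 2)%N //; [lra | lia].
  split=> [h|]; first by rewrite !inE in h; rewrite (@lin _ 0 2 2)%N //; [lra | lia].
  by move=> h; rewrite (@lin _ 0 0 2)%N //; [lra | lia].
- have e h : A 4%N = h -> (A 4%N)%:R = h%:R :> rat by move=> ->.
  do !split; rewrite ?inE => h;
    [apply: (e 1%N)|apply: (e 0%N)|apply: (e 0%N)|
     apply: (e 0%N)|apply: (e 1%N)|apply: (e 0%N)]; lia.
- split=> [h|]; first by rewrite (@lin _ 0 6 2)%N //; [lra | lia].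
  split=> [h|]; first by rewrite !inE in h; rewrite (@lin _ 0 1 2)%N //; [lra | lia].
  split=> [h|]; first by rewrite !inE in h; rewrite (@lin _ 0 2 2)%N //; [lra | lia].
  split=> [h|]; first by rewrite !inE in h; rewrite (@lin _ 0 3 2)%N //; [lra | lia].
  split=> [h|]; first by rewrite !inE in h; rewrite (@lin _ 0 4 2)%N //; [lra | lia].
  by move=> h; rewrite (@lin _ 0 4 2)%N //; [lra | lia].
- have e0 : A 6%N = 0%N -> (A 6%N)%:R = 0 :> rat by move=> ->.
  split=> [h|]; first by rewrite (@lin _ 0 4 4)%N //; [lra | lia].
  split=> [h|]; first by rewrite !inE in h; apply: e0; lia.
  split=> [h|]; first by rewrite !inE in h; rewrite (@lin _ 0 2 4)%N //; [lra | lia].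
  split=> [h|]; first by rewrite !inE in h; apply: e0; lia.
  split=> [h|]; first by rewrite !inE in h; rewrite (@lin _ 0 4 4)%N //; [lra | lia].
  by move=> h; rewrite (@lin _ 0 2 4)%N //; [lra | lia].
- have a6 : (m %% 2 = 1)%N -> (A 6%N)%:R = 0 :> rat by move=> e; rewrite c6 e.
  have a64 : (m %% 4 = 0)%N -> (A 6%N)%:R = (q + 0%:R - 4%:R) / 4%:R :> rat.
    by move=> e; apply: lin => //; lia.
  have a62 : (m %% 4 = 2)%N -> (A 6%N)%:R = (q + 0%:R - 2%:R) / 4%:R :> rat.
    by move=> e; apply: lin => //; lia.
  split=> [h|].
    have [k [qE]] := tri 12%N isT h; rewrite t12 a64; last by lia.
    by move: (A 7%N)%:R => x; rewrite qE => e; lra.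
  split=> [|].
    rewrite !inE => /or4P[]/eqP h.
    + have [k [qE]] := tri 1%N isT h; rewrite t5 // a6; last by lia.
      by move: (A 7%N)%:R => x; rewrite qE => e; lra.
    + have [k [qE]] := tri 5%N isT h; rewrite t5 // a6; last by lia.
      by move: (A 7%N)%:R => x; rewrite qE => e; lra.
    + have [k [qE]] := tri 7%N isT h; rewrite t7 // a6; last by lia.
      by move: (A 7%N)%:R => x; rewrite qE => e; lra.
    + have [k [qE]] := tri 11%N isT h; rewrite t11 // a6; last by lia.
      by move: (A 7%N)%:R => x; rewrite qE => e; lra.
  split=> [|].
    rewrite !inE => /orP[]/eqP h.
    + have [k [qE]] := tri 2%N isT h; rewrite t5 // a62; last by lia.
      by move: (A 7%N)%:R => x; rewrite qE => e; lra.
    + have [k [qE]] := tri 10%N isT h; rewrite t10 // a62; last by lia.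
      by move: (A 7%N)%:R => x; rewrite qE => e; lra.
  split=> [|].
    rewrite !inE => /orP[]/eqP h.
    + have [k [qE]] := tri 3%N isT h; rewrite t5 // a6; last by lia.
      by move: (A 7%N)%:R => x; rewrite qE => e; lra.
    + have [k [qE]] := tri 9%N isT h; rewrite t9 // a6; last by lia.
      by move: (A 7%N)%:R => x; rewrite qE => e; lra.
  split=> [|].
    rewrite !inE => /orP[]/eqP h.
    + have [k [qE]] := tri 4%N isT h; rewrite t5 // a64; last by lia.
      by move: (A 7%N)%:R => x; rewrite qE => e; lra.
    + have [k [qE]] := tri 8%N isT h; rewrite t8 // a64; last by lia.
      by move: (A 7%N)%:R => x; rewrite qE => e; lra.
  move=> h; have [k [qE]] := tri 6%N isT h; rewrite t6 // a62; last by lia.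
  by move: (A 7%N)%:R => x; rewrite qE => e; lra.
Qed.
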